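(* Let $\rho>0$, let the standing assumptions (A1)–(A5) listed in the context hold, and let $\tau_N>0$ be a sequence with $\tau_N\to\infty$. Let $\nu_N^c=\mathcal N\big(0,(\tau_N\rho\mathcal L)^{-1}\big)$ be the centered Gaussian measure on $L^2$ with covariance operator $(\tau_N\rho\mathcal L)^{-1}$, $\mathcal L=-\partial_t^2+\mathrm{Id}$ (periodic boundary conditions), and let $\mu_N^c$ be the probability measure on $L^2$ given by $$d\mu_N^c(f)=(Z_N^c)^{-1}\exp\{-\tau_N\Psi(f)\}\,d\nu_N^c(f),\qquad Z_N^c=\int_{L^2}\exp\{-\tau_N\Psi(f)\}\,d\nu_N^c(f).$$ Then $\mu_N^c\Rightarrow\delta_{u_*}$ weakly as probability measures on $L^2$ as $N\to\infty$, where $u_*$ is the unique minimizer of $\Psi^{\mathrm{full}}$ over $H^1(S^1)$.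
   Context: $S^1$ is the interval $[0,1]$ with endpoints glued; functions on $S^1$ are identified with $1$-periodic functions on $\mathbb{R}$. All functions are real valued, $C=C(S^1)$, $L^2=L^2(S^1)$. $N$ is a positive integer, $t_i=i/N$, vectors in $\mathbb{R}^N$ are written $\vec f=(f_0,\dots,f_{N-1})$ with the periodic convention $f_N=f_0$. Data of the problem: a linear operator $\mathcal K$, a function $g$ on $S^1$, a function $w:\mathbb{R}\to\mathbb{R}$, a function $\Phi:\mathbb{R}\times\mathbb{R}\times S^1\to\mathbb{R}$; $\partial_1$ denotes differentiation in the first argument of $\Phi$. Put $$\Psi(f)=\int_{S^1}\Phi\big((\mathcal K f)(t),g(t),t\big)\,dt\ \ (f\in L^2),\qquad \Psi^{\mathrm{full}}(f)=\Psi(f)+\frac{\rho}{2}\int_{S^1}\big(f(t)^2+|f'(t)|^2\big)\,dt\ \ (f\in H^1(S^1)).$$ The minimizer $u_*$ of $\Psi^{\mathrm{full}}$ over $H^1(S^1)$ exists and is unique under the assumptions below. Standing assumptions: (A1) $w\in L^\infty(\mathbb{R})$ has compact support and $\int_{\mathbb{R}}w=1$. (A2) $\mathcal K$ and its $L^2$-adjoint $\mathcal K^*$ are bounded from $L^2$ to $C$; $g\in C$. (A3) There are $h_0>0$ and $c\ge0$ such that $\Phi(p,g(t)+h,t)\ge -c$ and $\partial_1^2\Phi(p,g(t)+h,t)\ge0$ for all $p\in\mathbb{R}$, $t\in S^1$, $|h|\le h_0$. (A4) $\Phi$ is locally Lipschitz in $(p,v,t)$, and $\partial_1\Phi$, $\partial_1^2\Phi$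 exist and are continuous in $(p,v,t)$. (A5) For some $p_0>0$, $\partial_1^3\Phi(r_i+p,g_i,t_i)$ exists for $|p|\le p_0$ and $\sup_{N\ge N_1}\sup_{0\le i\le N-1}\sup_{|p|\le p_0}|\partial_1^3\Phi(r_i+p,g_i,t_i)|<\infty$. Here $g_i=N\int_{\mathbb{R}}w(N(t-t_i))g(t)\,dt$; $r_i=(\mathcal K_N\vec u_{*,N})_i$ with $(\mathcal K_N\vec f)_i=N\int_{\mathbb{R}}w(N(t-t_i))(\mathcal K\mathcal I_N\vec f)(t)\,dt$ and $(\mathcal I_N\vec f)(t)=f_m$ for $t\in[m/N,(m+1)/N)$; $\vec u_{*,N}$ is the unique minimizer over $\mathbb{R}^N$ of $\frac1N\sum_i\Phi((\mathcal K_N\vec f)_i,g_i,t_i)+\frac{\rho}{2N}\sum_i[f_i^2+N^2(f_{i+1}-f_i)^2]$; and $N_1$ is an integer such that $|g_i-g(t_i)|\le h_0$ for all $0\le i\le N-1$, $N\ge N_1$. *)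

(* Defs.v *)
From HB Require Import structures.
From mathcomp Require Import all_boot all_order all_algebra.
From mathcomp Require Import all_classical all_reals all_analysis.
From mathcomp Require Import measurable_realfun ess_sup_inf.

Set Implicit Arguments.
Unset Strict Implicit.
Unset Printing Implicit Defensive.

Import Order.TTheory GRing.Theory Num.Theory.
Import numFieldNormedType.Exports.

Local Open Scope classical_set_scope.
Local Open Scope ring_scope.

(* The library provides [LspaceType] as a bare type of almost-everywhere
   classes; it is equipped here with its normed-space structure. *)
Section Lspace_normedModType.
Context d (T : measurableType d) (R : realType).
Variable mu : {measure set T -> \bar R}.
Variables (p : \bar R) (p1 : (1 <= p)%E).

Local Notation LT := (LspaceType mu p1).
Local Notation FT := (LfunType mu p1).

HB.instance Definition _ := gen_eqMixin LT.
HB.instance Definition _ := gen_choiceMixin LT.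

Lemma Lnorm_ae_eq (f g : T -> R) :
  measurable_fun setT f -> measurable_fun setT g -> f = g %[ae mu] ->
  'N[mu]_p[EFin \o f]%E = 'N[mu]_p[EFin \o g]%E.
Proof.
move=> mf mg fg; rewrite unlock; case: p p1 => [r r1| |//].
- have mpow (h : T -> R) : measurable_fun setT h ->
      measurable_fun setT (fun x => (`|(EFin \o h) x| `^ r)%E).
    by move=> mh; apply/measurable_EFinP/(measurableT_comp (measurable_powR _)) => //;
      exact: measurableT_comp.
  congr (poweR _ _); apply: ge0_ae_eq_integral; [by []|exact: mpow|exact: mpow|..].
  + by move=> x _; exact: poweR_ge0.
  + by move=> x _; exact: poweR_ge0.
  + by apply: filterS fg => x /= /(_ I) -> _.
- move=> _; case: ifPn => // _; apply: eq_ess_sup.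
  by apply: filterS fg => x /= /(_ I) ->.
Qed.

Lemma measurable_aeEqMfun (f : {mfun_ mu, T >-> measurableTypeR R}) :
  measurable_fun setT (f : T -> R).
Proof. exact: (@measurable_funPT _ _ _ _ (repr f)). Qed.

Lemma Lrepr_Lfun (f : LT) : (f : T -> R) \in Lfun mu p.
Proof.
apply/andP; split.
  by rewrite inE; exact: measurable_aeEqMfun.
rewrite inE; exact: (@Lebesgue_finite _ _ _ _ _ _ f).
Qed.

Definition Lfun_of (f : LT) : FT := Lfun_Sub p1 (Lrepr_Lfun f).

Let Lmfun (f : FT) : {mfun T >-> measurableTypeR R} :=
  HB.pack (f : T -> measurableTypeR R)
    (isMeasurableFun.Build _ _ T (measurableTypeR R) f (@measurable_funPT _ _ _ _ f)).

Definition mfun_class (f : FT) : {mfun_ mu, T >-> measurableTypeR R} :=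
  (\pi_({mfun_ mu, T >-> measurableTypeR R}) (Lmfun f))%qT.

Lemma mfun_classP (f : FT) : (mfun_class f : T -> R) = (f : T -> R) %[ae mu].
Proof.
have /eqP : (\pi_({mfun_ mu, T >-> measurableTypeR R})
   (repr (mfun_class f)) =
  \pi_({mfun_ mu, T >-> measurableTypeR R}) (Lmfun f))%qT.
  by rewrite reprK.
by rewrite eqmodE => /asboolP.
Qed.

Lemma mfun_class_finite (f : FT) : finite_norm mu p (mfun_class f).
Proof.
rewrite /finite_norm (@Lnorm_ae_eq (mfun_class f) f).
- exact: Lfunction_finite.
- exact: measurable_aeEqMfun.
- exact: measurable_funPT.
- exact: mfun_classP.
Qed.

Definition Lclass (f : FT) : LT :=
  HB.pack (mfun_class f) (isFinLebesgue.Build _ _ _ _ _ p1 _ (mfun_class_finite f)).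

Lemma Lspace_sort_inj (f g : LT) :
  LebesgueSpace.sort f = LebesgueSpace.sort g -> f = g.
Proof.
case: f g => [f [[fP]]] [g [[gP]]] /= fg; subst g.
by rewrite (Prop_irrelevance fP gP).
Qed.

Lemma Lspace_eqP (f g : LT) : (f : T -> R) = (g : T -> R) %[ae mu] -> f = g.
Proof.
move=> fg; apply: Lspace_sort_inj.
rewrite -[LHS]reprK -[RHS]reprK; apply/eqP; rewrite eqmodE.
exact/asboolP.
Qed.

Lemma LclassE (f : FT) : (Lclass f : T -> R) = (f : T -> R) %[ae mu].
Proof. exact: mfun_classP. Qed.

Lemma Lclass_eq (f g : FT) : (f : T -> R) = (g : T -> R) %[ae mu] -> Lclass f = Lclass g.
Proof.
move=> fg; apply: Lspace_eqP.
apply: ae_eq_trans (LclassE f) _; apply: ae_eq_trans fg _.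
exact/ae_eq_sym/LclassE.
Qed.

Lemma Lfun_ofK : cancel Lfun_of Lclass.
Proof. by move=> f; apply: Lspace_eqP; exact: LclassE. Qed.

Let zero : LT := Lclass 0.
Let add (f g : LT) : LT := Lclass (Lfun_of f + Lfun_of g).
Let opp (f : LT) : LT := Lclass (- Lfun_of f).
Let scale (a : R) (f : LT) : LT := Lclass (a *: Lfun_of f).

Let addE (f g : FT) : add (Lclass f) (Lclass g) = Lclass (f + g).
Proof.
apply: Lclass_eq; apply: filterS2 (LclassE f) (LclassE g) => x /(_ I) fx /(_ I) gx _.
by rewrite /= !fctE /= fx gx.
Qed.

Let scaleE a (f : FT) : scale a (Lclass f) = Lclass (a *: f).
Proof.
apply: Lclass_eq; apply: filterS (LclassE f) => x /(_ I) fx _.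
by rewrite /= !fctE /= fx.
Qed.

Let oppE (f : FT) : opp (Lclass f) = Lclass (- f).
Proof.
apply: Lclass_eq; apply: filterS (LclassE f) => x /(_ I) fx _.
by rewrite /= !fctE /= fx.
Qed.

Let addA : associative add.
Proof.
move=> f g h; rewrite -(Lfun_ofK f) -(Lfun_ofK g) -(Lfun_ofK h).
by rewrite !addE addrA.
Qed.

Let addC : commutative add.
Proof. by move=> f g; rewrite /add addrC. Qed.

Let add0 : left_id zero add.
Proof. by move=> f; rewrite -(Lfun_ofK f) addE add0r. Qed.

Let addN : left_inverse zero opp add.
Proof. by move=> f; rewrite -(Lfun_ofK f) oppE addE addNr. Qed.

HB.instance Definition _ := GRing.isZmodule.Build LT addA addC add0 addN.

Lemma LclassD (f g : FT) : Lclass (f + g) = Lclass f + Lclass g.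
Proof. by rewrite -addE. Qed.

Let scaleA a b (f : LT) : scale a (scale b f) = scale (a * b) f.
Proof. by rewrite -(Lfun_ofK f) !scaleE scalerA. Qed.

Let scale1 : left_id 1 scale.
Proof. by move=> f; rewrite -(Lfun_ofK f) scaleE scale1r. Qed.

Let scaleDr : right_distributive scale +%R.
Proof.
move=> a f g; rewrite -(Lfun_ofK f) -(Lfun_ofK g) -LclassD !scaleE -LclassD.
by rewrite scalerDr.
Qed.

Let scaleDl (f : LT) : {morph scale^~ f : a b / a + b}.
Proof. by move=> a b; rewrite -(Lfun_ofK f) !scaleE -LclassD scalerDl. Qed.

HB.instance Definition _ :=
  GRing.Zmodule_isLmodule.Build R LT scaleA scale1 scaleDr scaleDl.

Lemma LclassZ a (f : FT) : Lclass (a *: f) = a *: Lclass f.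
Proof. by rewrite -scaleE. Qed.

Definition Lspace_norm (f : LT) : R :=
  fine ('N[mu]_p[EFin \o (f : T -> R)])%E.

Lemma Lspace_norm_class (f : FT) :
  Lspace_norm (Lclass f) = fine ('N[mu]_p[EFin \o f])%E.
Proof.
congr fine; apply: Lnorm_ae_eq; [|exact: measurable_funPT|exact: LclassE].
exact: measurable_aeEqMfun.
Qed.

Let normD (f g : LT) : Lspace_norm (f + g) <= Lspace_norm f + Lspace_norm g.
Proof.
rewrite -(Lfun_ofK f) -(Lfun_ofK g) -LclassD !Lspace_norm_class.
exact: ler_LnormD.
Qed.

Let normZ a (f : LT) : Lspace_norm (a *: f) = `|a| * Lspace_norm f.
Proof.
rewrite -(Lfun_ofK f) -LclassZ !Lspace_norm_class; apply: EFin_inj.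
rewrite EFinM !finite_norm_fine -LnormZ.
by [].
Qed.

Let norm0 (f : LT) : Lspace_norm f = 0 -> f = 0.
Proof.
rewrite -(Lfun_ofK f) Lspace_norm_class => /fine_Lnormr_eq0 f0.
exact: Lclass_eq.
Qed.

HB.instance Definition _ := Lmodule_isNormed.Build R LT normD normZ norm0.

End Lspace_normedModType.

Section circle.
Variable R : realType.

Lemma measurable_unit_itv : measurable (`[0, 1] : set (measurableTypeR R)).
Proof. exact: measurable_itv. Qed.

(* S^1 is [0, 1] with endpoints glued: points of S^1 are represented by reals,
   functions on S^1 by 1-periodic functions on R, and dt by the Lebesgue
   measure restricted to one period. *)
Definition S1_measure : {measure set (measurableTypeR R) -> \bar R} :=
  mrestr (@lebesgue_measure R) measurable_unit_itv.

Definition L2 : Type := LspaceType2 S1_measure.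

HB.instance Definition _ :=
  NormedModule.copy L2 (LspaceType S1_measure (lee1n 2)).

Definition C_S1 : set (R -> R) := [set f : R -> R | continuous f /\ periodic f 1].

Definition inner (f h : L2) : R := \int[S1_measure]_t (f t * h t).

(* The class in L2 of a square integrable function (junk value 0 otherwise). *)
Definition L2_class (f : R -> R) : L2 :=
  xget 0 [set u : L2 | (u : R -> R) = f %[ae S1_measure]].

Definition test_function (phi : R -> R) : Prop :=
  periodic phi 1 /\ forall n t, derivable (derive1n n phi) t 1.

Definition weak_deriv (u v : L2) : Prop := forall phi, test_function phi ->
  \int[S1_measure]_t (u t * derive1 phi t) = - \int[S1_measure]_t (v t * phi t).

Definition H1 : set L2 := [set u | exists v, weak_deriv u v].

Definition wderiv (u : L2) : L2 := xget 0 (weak_deriv u).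

(* Graph of L = - d^2/dt^2 + Id, whose domain is H^2(S^1). *)
Definition calL (u v : L2) : Prop :=
  exists u' u'' : L2, [/\ weak_deriv u u', weak_deriv u' u'' & v = - u'' + u].

Definition scaled (a : R) (G : L2 -> L2 -> Prop) (u v : L2) : Prop :=
  exists2 v0, G u v0 & v = a *: v0.

(* C is the everywhere defined inverse of the operator with graph G. *)
Definition inverse_operator (G : L2 -> L2 -> Prop) (C : L2 -> L2) : Prop :=
  forall u v, C v = u <-> G u v.

Definition bounded_L2_C (K : L2 -> R -> R) : Prop :=
  (forall f, C_S1 (K f)) /\ exists M : R, forall f t, `|K f t| <= M * `|f|.

Definition L2_adjoint (K Ks : L2 -> R -> R) : Prop := forall f h : L2,
  \int[S1_measure]_t (K f t * h t) = \int[S1_measure]_t (f t * Ks h t).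

End circle.

Section measures.
Variable R : realType.

Definition Borel (T : ptopologicalType) := g_sigma_algebraType (@open T).

Definition weak_cvg (T : ptopologicalType) (mu_ : nat -> probability (Borel T) R)
    (mu : probability (Borel T) R) : Prop :=
  forall F : T -> R, continuous F -> bounded_fun F ->
    (\int[mu_ N]_x F x) @[N --> \oo] --> \int[mu]_x F x.

(* N(m, v) on the line, v being the variance; [normal_prob] takes the standard
   deviation and does not cover the degenerate case. *)
Definition gaussian_law (m v : R) : set (measurableTypeR R) -> \bar R :=
  if v == 0 then dirac m else normal_prob m (Num.sqrt v).

(* nu = N(m, C): each <., h> has law N(<m, h>, <C h, h>). *)
Definition gaussian_measure (nu : probability (Borel (L2 R)) R)
    (m : L2 R) (C : L2 R -> L2 R) : Prop :=
  forall (h : L2 R) (A : set (measurableTypeR R)), measurable A ->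
    nu [set f | A (inner f h)] = gaussian_law (inner m h) (inner (C h) h) A.

Definition gibbs_measure (nu mu : probability (Borel (L2 R)) R)
    (V : L2 R -> R) : Prop :=
  let Z : R := \int[nu]_f expR (- V f) in
  forall A : set (Borel (L2 R)), measurable A ->
    mu A = (Z^-1%:E * \int[nu]_(f in A) (expR (- V f))%:E)%E.

Definition minimizer (T : Type) (D : set T) (J : T -> R) (u : T) : Prop :=
  D u /\ forall v, D v -> J u <= J v.

End measures.

Section problem.
Variables (R : realType) (rho : R) (w g : R -> R) (Phi : R -> R -> R -> R).
Variable K : L2 R -> R -> R.

Definition d1 (n : nat) (p v t : R) : R := derive1n n (fun q => Phi q v t) p.

Definition ex_d1 (n : nat) (p v t : R) : Prop :=
  derivable (fun q => d1 n.-1 q v t) p 1.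

Definition Psi (f : L2 R) : R :=
  \int[S1_measure R]_t Phi (K f t) (g t) t.

Definition Psi_full (f : L2 R) : R :=
  Psi f + rho / 2 *
    \int[S1_measure R]_t (f t ^+ 2 + `|wderiv f t| ^+ 2).

Definition node (N i : nat) : R := i%:R / N%:R.

Definition sampling (N i : nat) (f : R -> R) : R :=
  N%:R * \int[@lebesgue_measure R]_t (w (N%:R * (t - node N i)) * f t).

Definition step_fun (N : nat) (f : 'rV[R]_N) (t : R) : R :=
  \sum_(m < N) f ord0 m * \1_(`[node N m, node N m.+1[) t.

Definition K_N (N : nat) (f : 'rV[R]_N) (i : 'I_N) : R :=
  sampling N i (K (L2_class (step_fun f))).

(* [ordS i] is i + 1 modulo N *)
Definition Psi_full_N (N : nat) (f : 'rV[R]_N) : R :=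
  N%:R^-1 * \sum_(i < N) Phi (K_N f i) (sampling N i g) (node N i)
  + rho / (2 * N%:R) *
    \sum_(i < N) (f ord0 i ^+ 2 + N%:R ^+ 2 * (f ord0 (ordS i) - f ord0 i) ^+ 2).

Definition assumption_A1 : Prop :=
  [/\ w \in Lfun (@lebesgue_measure R) +oo%E,
      exists2 A : set R, compact A &
        {ae @lebesgue_measure R, forall x, ~ A x -> w x = 0}
    & \int[@lebesgue_measure R]_x w x = 1].

Definition assumption_A2 : Prop :=
  [/\ bounded_L2_C K,
      exists2 Ks, L2_adjoint K Ks & bounded_L2_C Ks
    & C_S1 g].

Definition assumption_A3 (h0 c : R) : Prop :=
  [/\ 0 < h0, 0 <= c &
    forall p t h, `|h| <= h0 ->
      - c <= Phi p (g t + h) t /\ 0 <= d1 2 p (g t + h) t].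

Definition assumption_A4 : Prop :=
  [/\ forall z : R * R * R, exists M : R, \forall x \near z & y \near z,
        `|Phi x.1.1 x.1.2 x.2 - Phi y.1.1 y.1.2 y.2| <= M * `|x - y|,
      forall p v t, ex_d1 1 p v t /\ ex_d1 2 p v t,
      continuous (fun z : R * R * R => d1 1 z.1.1 z.1.2 z.2)
    & continuous (fun z : R * R * R => d1 2 z.1.1 z.1.2 z.2)].

Definition admissible_N1 (h0 : R) (N1 : nat) : Prop :=
  forall N (i : 'I_N), (0 < N)%N -> (N1 <= N)%N ->
    `|sampling N i g - g (node N i)| <= h0.

Definition assumption_A5 (N1 : nat) : Prop :=
  exists p0 M : R, 0 < p0 /\
    forall N (u : 'rV[R]_N) (i : 'I_N) p,
      (0 < N)%N -> (N1 <= N)%N ->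
      unique (minimizer setT (@Psi_full_N N)) u ->
      `|p| <= p0 ->
      let r := K_N u i in
      ex_d1 3 (r + p) (sampling N i g) (node N i) /\
      `|d1 3 (r + p) (sampling N i g) (node N i)| <= M.

End problem.

(* Main.v *)
Require Import Defs.
From HB Require Import structures.
From mathcomp Require Import all_boot all_order all_algebra.
From mathcomp Require Import all_classical all_reals all_analysis.
From mathcomp Require Import measurable_realfun ring lra.
Import Order.TTheory GRing.Theory Num.Theory.
Import numFieldNormedType.Exports.
Set Implicit Arguments.
Unset Strict Implicit.
Unset Printing Implicit Defensive.
Local Open Scope classical_set_scope.
Local Open Scope ring_scope.

(** With u the minimizer, convexity of Psi gives
    Psi f = Psi u + <grad Psi u, f - u> + r (f - u), where 0 <= r v, and
    r v <= M |v|^2 for |v| <= 1. Setting h := - tau grad Psi u, the Euler-Lagrange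
    equation says that u = C h, with C the covariance of nu_N, and exp (- tau Psi)
    is, up to a constant, exp <., h> exp (- tau r (. - u)). The measure
    exp <., h> nu_N is proportional to the Gaussian measure with mean u; the bound
    of order 1 / tau on its second moment E |f - u|^2 is all that is needed: the
    part of mu_N outside a ball around u is O (1 / tau) by Chebyshev's inequality.

    This moment is obtained without the Cameron-Martin theorem. Second moments
    of <f - u, k> follow from the one-dimensional moment generating functions of
    nu_N at h + s k and h - s k, and they are summed over the indicators k of the
    cells of a fine partition (Lebesgue differentiation and Fatou's lemma recover
    the norm), because <C k, k> is at most a constant times |k|_1 ^ 2 / tau.

    The minimizer exists because the energy is strongly convex in H^1, which makes
    minimizing sequences Cauchy. *)

(** * The Lebesgue measure on the circle *)

(** The second-moment bound is a trace bound in disguise: E |f - u|^2 under the tilted measure is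
    the trace of C, and it is reached without eigenfunctions. Elements of H^1 are bounded, so <C k,
    k> <= 9 |k|_1 ^ 2 / a with a = tau rho. Here the L^1 norm is essential. Take the n cells of
    length 1 / n, with weights n that make their indicators orthonormal: the variances add up to n *
    n * 9 / (a n ^ 2) = 9 / a, uniformly in n, whereas a bound through |k|_2 ^ 2 = 1 / n would
    diverge with n.

    The other obstacle is the partition function, which must not be too small. Where tau |f - u| ^ 2
    <= 4 S and |f - u| <= 1, with S / tau the moment bound, the perturbation tau r is at most 4 M S.
    For large tau this region carries at least half of the tilted mass, so the partition function
    loses only a constant factor against the tilted one. All other normalizing factors cancel in the
    quotient, and no asymptotics of the partition function are needed. *)

Section circle_measure.
Context {R : realType}.
Local Notation mu := (S1_measure R).
Local Notation leb := (@lebesgue_measure R).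

Lemma S1_measure_setT : mu setT = 1%E.
Proof.
rewrite /S1_measure/= /mrestr setTI lebesgue_measure_itv/= lte01.
by rewrite -EFinB subr0.
Qed.

Definition S1_prob : probability (measurableTypeR R) R :=
  HB.pack (Measure.sort mu)
    (Measure_isProbability.Build _ _ _ (Measure.sort mu) S1_measure_setT).

#[global] Instance S1_ae_filter : Filter (nbhs (almost_everywhere mu)).
Proof. exact: (ae_filter_ringOfSetsType mu). Qed.

Lemma S1_measure_le (A : set R) : measurable A -> (mu A <= leb A)%E.
Proof.
move=> mA; rewrite /S1_measure/= /mrestr.
apply: le_measure; rewrite ?inE//; exact: measurableI.
Qed.

Lemma S1_measureE (A : set R) : A `<=` `[0, 1] -> mu A = leb A.
Proof. by move=> A01; rewrite /S1_measure/= /mrestr setIidl. Qed.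

Lemma S1_ae (P : R -> Prop) : {ae leb, forall x, P x} -> {ae mu, forall x, P x}.
Proof.
move=> [N [mN N0 PN]]; exists N; split => //.
by apply/eqP; rewrite eq_le measure_ge0 andbT -N0 S1_measure_le.
Qed.

Lemma S1_ae01 : {ae mu, forall x, `[0, 1]%classic x}.
Proof.
exists (~` `[0, 1]); split => //; first exact: measurableC.
by rewrite /S1_measure/= /mrestr setICl measure0.
Qed.

Lemma integral_S1 (f : R -> \bar R) : measurable_fun setT f ->
  (\int[mu]_x f x = \int[leb]_(x in `[0%R, 1%R]) f x)%E.
Proof.
move=> mf; transitivity (\int[mu]_(x in `[0%R, 1%R]) f x)%E.
  rewrite [RHS]integral_mkcond; apply: ae_eq_integral => //.
    by apply/(measurable_restrictT _ _).1 => //; exact: measurable_funTS.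
  by apply: filterS S1_ae01 => x x01 _; rewrite patchE mem_set.
by apply: eq_measure_integral => A _ /S1_measureE.
Qed.

Lemma ae_eq_Rintegral d (T : measurableType d) (m : {measure set T -> \bar R})
    (f g : T -> R) :
  measurable_fun setT f -> measurable_fun setT g -> f = g %[ae m] ->
  \int[m]_x f x = \int[m]_x g x.
Proof.
move=> mf mg fg; congr fine; apply: ae_eq_integral => //;
  try exact/measurable_EFinP.
by apply: filterS fg => x /= /(_ I) ->.
Qed.

Lemma periodic_nat (f : R -> R) (n : nat) x : periodic f 1 -> f (x + n%:R) = f x.
Proof.
move=> pf; elim: n => [|n IH]; first by rewrite addr0.
by rewrite -natr1 addrA pf.
Qed.

Lemma periodic_reduce (f : R -> R) x : periodic f 1 ->
  exists2 y, `[0, 1]%classic y & f x = f y.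
Proof.
move=> pf; have /andP[l u] := floor_itv x; rewrite intrD in u.
exists (x - (Num.floor x)%:~R).
  by rewrite /= in_itv/=; apply/andP; split; lra.
case: (Num.floor x) => n.
  by rewrite -[in LHS](subrK n%:~R x); exact: periodic_nat.
by rewrite NegzE mulrNz opprK; exact/esym/periodic_nat.
Qed.

Lemma compact_bounded_fun (T : topologicalType) (A : set T) (f : T -> R) :
  compact A -> continuous f -> exists M, forall x, A x -> `|f x| <= M.
Proof.
move=> cA cf; have cfA : compact (f @` A).
  by apply: continuous_compact => //; exact: continuous_subspaceT.
have [M [_ /(_ (M + 1))]] := compact_bounded cfA.
rewrite ltrDl ltr01 => /(_ erefl) HM.
by exists (M + 1) => x Ax; apply: HM; exists x.
Qed.

Lemma C_S1_bounded (f : R -> R) : C_S1 f -> exists M, forall x, `|f x| <= M.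
Proof.
move=> [cf pf]; have [M HM] := compact_bounded_fun (@segment_compact R 0 1) cf.
by exists M => x; have [y y01 ->] := periodic_reduce x pf; exact: HM.
Qed.

Lemma bounded_Lfun (d : measure_display) (T : measurableType d)
    (P : probability T R) (f : T -> R) (M : R) :
  measurable_fun setT f -> (forall x, `|f x| <= M) -> f \in Lfun P 2%:E.
Proof.
move=> mf fM; have M0 : 0 <= M by apply: le_trans (fM point).
rewrite inE; apply/andP; split; rewrite inE //=.
rewrite /finite_norm unlock /=.
apply: poweR_lty.
apply: (@le_lt_trans _ _ (\int[P]_x (cst ((M ^+ 2)%:E) x)))%E; last first.
  by rewrite integral_cst//= probability_setT mule1 ltry.
apply: ge0_le_integral => //.
- apply/measurable_EFinP/(measurableT_comp (measurable_powR _)) => //.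
  exact: measurableT_comp.
- move=> x _ /=; rewrite lee_fin powR_mulrn//.
  by rewrite lerXn2r// nnegrE.
Qed.

End circle_measure.

(** * The Hilbert space L2 *)

Section hilbert.
Context {R : realType}.
Local Notation mu := (S1_measure R).
Implicit Types f g h : L2 R.

Lemma L2_Lfun f : (f : R -> R) \in Lfun mu 2%:E.
Proof. exact: Lrepr_Lfun. Qed.

Lemma L2_measurable f : measurable_fun [set: measurableTypeR R] (f : R -> R).
Proof. by have := L2_Lfun f; rewrite inE => /andP[]; rewrite inE. Qed.

Definition L2_of (f : R -> R) (Hf : f \in Lfun mu 2%:E) : L2 R :=
  Lclass (Lfun_Sub (lee1n 2) Hf).

Lemma L2_ofE (f : R -> R) (Hf : f \in Lfun mu 2%:E) :
  (L2_of Hf : R -> R) = f %[ae mu].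
Proof. exact: LclassE. Qed.

Lemma L2_eq f g : (f : R -> R) = (g : R -> R) %[ae mu] -> f = g.
Proof. exact: Lspace_eqP. Qed.

Lemma L2_addE f g : ((f + g : L2 R) : R -> R) = (fun t => f t + g t) %[ae mu].
Proof.
have := LclassE (Lfun_of f + Lfun_of g).
by rewrite LclassD !Lfun_ofK.
Qed.

Lemma L2_scaleE a f : ((a *: f : L2 R) : R -> R) = (fun t => a * f t) %[ae mu].
Proof.
by have := LclassE (a *: Lfun_of f); rewrite LclassZ Lfun_ofK.
Qed.

Lemma L2_oppE f : ((- f : L2 R) : R -> R) = (fun t => - f t) %[ae mu].
Proof.
rewrite -scaleN1r; apply: filterS (L2_scaleE (-1) f) => t /(_ I) -> _.
by rewrite mulN1r.
Qed.

Lemma Lfun2_mul_integrable (u v : R -> R) :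
  u \in Lfun mu 2%:E -> v \in Lfun mu 2%:E ->
  mu.-integrable setT (EFin \o (fun t => u t * v t)).
Proof. by move=> Hu Hv; exact/Lfun1_integrable/Lfun2_mul_Lfun1. Qed.

Lemma Lfun2_integrable (u : R -> R) : u \in Lfun mu 2%:E ->
  mu.-integrable setT (EFin \o u).
Proof.
move=> Hu; apply/Lfun1_integrable; apply: Lfun_subset12 Hu.
by rewrite S1_measure_setT.
Qed.

Lemma Lfun2_measurable (u : R -> R) : u \in Lfun mu 2%:E ->
  measurable_fun [set: measurableTypeR R] u.
Proof. by rewrite inE => /andP[]; rewrite inE. Qed.

Lemma inner_integrable f h : mu.-integrable setT (EFin \o (fun t => f t * h t)).
Proof. exact: Lfun2_mul_integrable (L2_Lfun _) (L2_Lfun _). Qed.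

Lemma inner_ae f h (u v : R -> R) :
  measurable_fun [set: measurableTypeR R] u ->
  measurable_fun [set: measurableTypeR R] v ->
  (f : R -> R) = u %[ae mu] -> (h : R -> R) = v %[ae mu] ->
  inner f h = \int[mu]_t (u t * v t).
Proof.
move=> mu_ mv fu hv; apply: ae_eq_Rintegral.
- by apply: measurable_funM; exact: L2_measurable.
- exact: measurable_funM.
- by apply: filterS2 fu hv => t /(_ I) -> /(_ I) -> _.
Qed.

Lemma innerC f h : inner f h = inner h f.
Proof. by apply: eq_Rintegral => t _; rewrite mulrC. Qed.

Lemma innerDl f g h : inner (f + g) h = inner f h + inner g h.
Proof.
rewrite (@inner_ae _ _ (fun t => f t + g t) h) //.
- rewrite -RintegralD//; [|exact: inner_integrable..].
  by apply: eq_Rintegral => t _; rewrite mulrDl.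
- by apply: measurable_funD; exact: L2_measurable.
- exact: L2_measurable.
- exact: L2_addE.
- exact: aeW.
Qed.

Lemma innerZl a f h : inner (a *: f) h = a * inner f h.
Proof.
rewrite (@inner_ae _ _ (fun t => a * f t) h) //.
- rewrite -RintegralZl//; last exact: inner_integrable.
  by apply: eq_Rintegral => t _; rewrite mulrA.
- by apply: measurable_funM => //; exact: L2_measurable.
- exact: L2_measurable.
- exact: L2_scaleE.
- exact: aeW.
Qed.

Lemma innerDr f g h : inner h (f + g) = inner h f + inner h g.
Proof. by rewrite !(innerC h) innerDl. Qed.

Lemma innerZr a f h : inner h (a *: f) = a * inner h f.
Proof. by rewrite !(innerC h) innerZl. Qed.

Lemma innerNl f h : inner (- f) h = - inner f h.
Proof. by rewrite -scaleN1r innerZl mulN1r. Qed.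

Lemma innerNr f h : inner h (- f) = - inner h f.
Proof. by rewrite -scaleN1r innerZr mulN1r. Qed.

Lemma innerBl f g h : inner (f - g) h = inner f h - inner g h.
Proof. by rewrite innerDl innerNl. Qed.

Lemma innerBr f g h : inner h (f - g) = inner h f - inner h g.
Proof. by rewrite innerDr innerNr. Qed.

Lemma inner0l h : inner 0 h = 0.
Proof. by rewrite -(scale0r 0) innerZl mul0r. Qed.

Lemma inner0r h : inner h 0 = 0.
Proof. by rewrite innerC inner0l. Qed.

Lemma inner_ofl (u : R -> R) (Hu : u \in Lfun mu 2%:E) h :
  inner (L2_of Hu) h = \int[mu]_t (u t * h t).
Proof.
apply: inner_ae => //; [exact: Lfun2_measurable|exact: L2_measurable|exact: L2_ofE|].
exact: aeW.
Qed.

Lemma inner_ofr (u : R -> R) (Hu : u \in Lfun mu 2%:E) h :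
  inner h (L2_of Hu) = \int[mu]_t (h t * u t).
Proof.
by rewrite innerC inner_ofl; apply: eq_Rintegral => t _; rewrite mulrC.
Qed.

Lemma norm_sqr f : `|f| ^+ 2 = inner f f.
Proof.
have f2 := L2_Lfun f.
have : ('N[mu]_2%:E[EFin \o (f : R -> R)] `^ 2 = \int[mu]_x `|(f x)%:E| `^ 2)%E.
  by rewrite poweR_Lnorm.
have -> : ('N[mu]_2%:E[EFin \o (f : R -> R)] = `|f|%:E)%E.
  rewrite -[RHS]/((fine ('N[mu]_2%:E[EFin \o (f : R -> R)]))%:E) fineK//.
  rewrite fin_numE; apply/andP; split.
    by apply/eqP => N; have := Lnorm_ge0 mu 2%:E (EFin \o (f : R -> R)); rewrite N.
  move: f2; rewrite inE => /andP[_]; rewrite inE /= /finite_norm.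
  by rewrite ltey.
rewrite poweR_EFin powR_mulrn// => /(congr1 fine)/= ->.
congr fine; apply: eq_integral => t _; congr EFin.
by rewrite powR_mulrn// real_normK ?num_real// expr2.
Qed.

Lemma inner_ge0 f : 0 <= inner f f.
Proof. by rewrite -norm_sqr sqr_ge0. Qed.

Lemma norm_sqrD f g : `|f + g| ^+ 2 = `|f| ^+ 2 + 2 * inner f g + `|g| ^+ 2.
Proof. by rewrite !norm_sqr innerDl !innerDr (innerC g f); ring. Qed.

Lemma norm_sqrB f g : `|f - g| ^+ 2 = `|f| ^+ 2 - 2 * inner f g + `|g| ^+ 2.
Proof. by rewrite norm_sqrD innerNr normrN; ring. Qed.

(** The vector squared in the proof is the residual of projecting f onto g, multiplied by |g|^2 to
    avoid a denominator. *)
Lemma cauchy_schwarz f g : `|inner f g| <= `|f| * `|g|.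
Proof.
have [->|g0] := eqVneq g 0; first by rewrite inner0r normr0 mulr_ge0.
have ng : 0 < `|g| by rewrite normr_gt0.
have := sqr_ge0 (`|(`|g| ^+ 2) *: f - inner f g *: g|).
rewrite norm_sqrB !norm_sqr !(innerZl, innerZr) -!norm_sqr => H.
rewrite -ler_sqr ?nnegrE ?mulr_ge0// real_normK ?num_real//.
rewrite -(ler_pM2l (exprn_gt0 2 ng)) exprMn.
by move: H; set A := inner f g; set a := `|f|; set b := `|g|; nra.
Qed.

Lemma L2_nbhsP f (P : set (L2 R)) :
  nbhs f P <-> exists2 d : R, 0 < d & forall g, `|f - g| < d -> P g.
Proof.
split=> [/nbhs_normP[d d0 dP]|[d d0 dP]]; first by exists d.
by apply/nbhs_normP; exists d.
Qed.

Lemma L2_continuousP (F : L2 R -> R) : continuous F <->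
  forall f e, 0 < e -> exists2 d : R, 0 < d &
    forall g, `|f - g| < d -> `|F f - F g| < e.
Proof.
split=> [cF f e e0|cF f].
  by have /cvgrPdist_lt/(_ e e0)/L2_nbhsP := cF f.
by apply/(@cvgrPdist_lt _ _ _ _ (nbhs_filter f)) => e e0; apply/L2_nbhsP; exact: cF.
Qed.

Lemma inner_continuous h : continuous (fun f : L2 R => inner f h).
Proof.
apply/L2_continuousP => f e e0; exists (e / (`|h| + 1)).
  by rewrite divr_gt0// ltr_wpDl.
move=> g; rewrite ltr_pdivlMr ?ltr_wpDl// mulrDr mulr1 => H.
rewrite -innerBl; apply: le_lt_trans (cauchy_schwarz _ _) _.
by apply: le_lt_trans H; rewrite lerDl.
Qed.

End hilbert.

(** * Completeness of L2 *)

Section completeness.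
Context {R : realType}.
Local Notation mu := (S1_measure R).

Lemma limn_einf_le (u : (\bar R)^nat) (B : \bar R) :
  (forall n, u n <= B)%E -> (limn_einf u <= B)%E.
Proof.
move=> uB; rewrite limn_einf_lim; apply: lime_le; first exact: is_cvg_einfs.
apply: nearW => n; apply: le_trans (uB n).
by apply: ereal_inf_lbound; exists n => /=.
Qed.

Lemma fatou_ae_le d (T : measurableType d) (m : {measure set T -> \bar R})
    (F : nat -> T -> R) (G : T -> R) (B : \bar R) :
  (forall n, measurable_fun setT (F n)) -> measurable_fun setT G ->
  (forall n x, 0 <= F n x) ->
  {ae m, forall x, F n x @[n --> \oo] --> G x} ->
  (forall n, \int[m]_x (F n x)%:E <= B)%E ->
  (\int[m]_x (G x)%:E <= B)%E.
Proof.
move=> mF mG F0 FG FB.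
have mFE n : measurable_fun setT (EFin \o F n) by exact/measurable_EFinP.
apply: (@le_trans _ _ (\int[m]_x (limn_einf (fun n => (F n x)%:E)))%E); last first.
  apply: le_trans (fatou m measurableT mFE _) _.
    by move=> n x _; rewrite lee_fin.
  exact: limn_einf_le.
rewrite le_eqVlt; apply/orP; left; apply/eqP; apply: ae_eq_integral => //.
- exact/measurable_EFinP.
- rewrite /limn_einf; apply: (measurableT_comp (@oppe_measurable R setT)).
  apply: (@measurable_fun_limn_esup _ _ _ _ (fun n x => (- (F n x)%:E)%E)) => n.
  exact: (measurableT_comp (@oppe_measurable R setT) (mFE n)).
- apply: filterS FG => x Fx _.
  have /cvg_limn_einf_sup[-> _] // : (F n x)%:E @[n --> \oo] --> (G x)%:E.
  by apply: cvg_EFin => //; exact: nearW.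
Qed.

(** Cauchy-Schwarz for |f| against the constant 1, on a space of total mass one. *)
Lemma inner_one_le (f : L2 R) : \int[mu]_t `|f t| <= `|f|.
Proof.
have Hf : (fun t => `|f t|) \in Lfun mu 2%:E.
  have := L2_Lfun f; rewrite !inE => /andP[]; rewrite !inE => mf nf.
  apply/andP; split; rewrite !inE/=; first exact: measurableT_comp.
  move: nf; rewrite /= /finite_norm -[X in (X < _)%E -> _]Lnorm_abse.
  by rewrite (_ : abse \o _ = EFin \o (fun t => `|f t|)).
have H1 : (fun=> 1 : R) \in Lfun mu 2%:E.
  by apply: (@bounded_Lfun _ _ _ S1_prob _ 1) => // x; rewrite normr1.
have -> : \int[mu]_t `|f t| = inner (L2_of Hf) (L2_of H1).
  rewrite (@inner_ae _ _ _ (fun t => `|f t|) (fun=> 1)).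
  - by apply: eq_Rintegral => t _; rewrite mulr1.
  - exact: Lfun2_measurable.
  - by [].
  - exact: L2_ofE.
  - exact: L2_ofE.
apply: le_trans (ler_norm _) _; apply: le_trans (cauchy_schwarz _ _) _.
have -> : `|L2_of H1| = 1.
  apply/eqP; rewrite -(@eqrXn2 _ 2)// norm_sqr expr1n; apply/eqP.
  rewrite (@inner_ae _ _ _ (fun=> 1) (fun=> 1)) //; [|exact: L2_ofE..].
  by rewrite Rintegral_cst// mul1r mul1r S1_measure_setT.
rewrite mulr1 le_eqVlt; apply/orP; left.
rewrite -(@eqrXn2 _ 2)// !norm_sqr; apply/eqP.
rewrite (@inner_ae _ _ _ (fun t => `|f t|) (fun t => `|f t|)).
- by apply: eq_Rintegral => t _; rewrite -expr2 real_normK ?num_real// expr2.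
- exact: Lfun2_measurable.
- exact: Lfun2_measurable.
- exact: L2_ofE.
- exact: L2_ofE.
Qed.

Lemma sum_half_le (n : nat) : \sum_(0 <= k < n) (2^-1 ^+ k : R) <= 2.
Proof.
suff -> : \sum_(0 <= k < n) (2^-1 ^+ k : R) = 2 - 2 * 2^-1 ^+ n.
  by rewrite lerBlDl lerDr mulr_ge0 ?exprn_ge0 ?invr_ge0.
elim: n => [|n IH]; first by rewrite big_geq// expr0 mulr1 subrr.
by rewrite big_nat_recr//= IH exprS; lra.
Qed.

Lemma L2_geometric_dist (u : nat -> L2 R) :
  (forall n, `|u n.+1 - u n| <= 2^-1 ^+ n) ->
  forall n k, `|u (n + k)%N - u n| <= 2 * 2^-1 ^+ n.
Proof.
move=> Hu n k; apply: (@le_trans _ _ (2^-1 ^+ n * \sum_(0 <= i < k) 2^-1 ^+ i)).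
  elim: k => [|k IH]; first by rewrite addn0 subrr normr0 big_geq// mulr0.
  rewrite big_nat_recr//= mulrDr -exprD -(subrKA (u (n + k)%N)) addnS addrC.
  by apply: le_trans (ler_normD _ _) _; rewrite lerD.
by rewrite mulrC ler_pM2r ?exprn_gt0 ?invr_gt0// sum_half_le.
Qed.

(** The series of the increments |u (n+1) - u n| has integral at most 2, so it is finite almost
    everywhere; there the telescoping series converges absolutely. *)
Lemma geometric_ae_cvg (u : nat -> L2 R) :
  (forall n, `|u n.+1 - u n| <= 2^-1 ^+ n) ->
  {ae mu, forall t, cvgn (fun n => u n t)}.
Proof.
move=> Hu; pose D n t := `|u n.+1 t - u n t|.
have mD n : measurable_fun [set: measurableTypeR R] (D n).
  by apply: measurableT_comp => //; apply: measurable_funB; exact: L2_measurable.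
have intD n : (\int[mu]_t (D n t)%:E <= (2^-1 ^+ n)%:E)%E.
  apply: le_trans (_ : (\int[mu]_t `|(u n.+1 - u n) t|)%:E <= _)%E; last first.
    by rewrite lee_fin; apply: le_trans (inner_one_le _) (Hu n).
  rewrite /Rintegral fineK; last first.
    apply: integrable_fin_num => //.
    have /Lfun2_integrable/integrable_norm := L2_Lfun (u n.+1 - u n).
    exact.
  rewrite le_eqVlt; apply/orP; left; apply/eqP; apply: ae_eq_integral => //.
  - exact/measurable_EFinP.
  - by apply/measurable_EFinP; apply: measurableT_comp => //; exact: L2_measurable.
  - apply: filterS2 (L2_addE (u n.+1) (- u n)) (L2_oppE (u n)) => t.
    by move=> /(_ I) -> /(_ I) -> _.
have intS : mu.-integrable setT (fun t => \sum_(0 <= n <oo) (D n t)%:E)%E.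
  apply/integrableP; split.
    apply: ge0_emeasurable_sum => [n t _ _|n _]; first by rewrite lee_fin /D normr_ge0.
    by exact/measurable_EFinP.
  rewrite (eq_integral (fun t => \sum_(0 <= n <oo) (D n t)%:E)%E); last first.
    move=> t _; rewrite gee0_abs// nneseries_ge0// => n _ _.
    by rewrite lee_fin /D normr_ge0.
  rewrite integral_nneseries//; last 2 first.
    by move=> n; exact/measurable_EFinP.
    by move=> n t _; rewrite lee_fin /D normr_ge0.
  apply: (@le_lt_trans _ _ 2%:E); last exact: ltry.
  apply: lime_le.
    apply: is_cvg_nneseries => n _ _; apply: integral_ge0 => t _.
    by rewrite lee_fin /D.
  apply: nearW => n; apply: le_trans (_ : (\sum_(0 <= k < n) (2^-1 ^+ k)%:E <= _))%E.
    by apply: lee_sum => k _; exact: intD.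
  by rewrite sumEFin lee_fin sum_half_le.
apply: filterS (integrable_ae measurableT intS) => t /(_ I) fint.
have cD : cvgn (series (telescope (fun n => u n t))).
  apply: normed_cvg; apply: nondecreasing_is_cvgn.
    by apply: nondecreasing_series => n _ _; exact: normr_ge0.
  exists (fine (\sum_(0 <= n <oo) (D n t)%:E)%E) => _ [n _ <-].
  rewrite -lee_fin fineK// /series/= -sumEFin.
  by apply: nneseries_lim_ge => k _ _; rewrite lee_fin.
have -> : (fun n => u n t) = (fun n => u 0%N t + series (telescope (fun n => u n t)) n).
  by apply/funext => n; rewrite -eq_sum_telescope.
by apply: is_cvgD => //; exact: is_cvg_cst.
Qed.

(* Riesz-Fischer, for sequences with geometrically decreasing increments. *)
Lemma L2_complete (u : nat -> L2 R) :
  (forall n, `|u n.+1 - u n| <= 2^-1 ^+ n) ->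
  exists l : L2 R, forall n, `|u n - l| <= 2 * 2^-1 ^+ n.
Proof.
move=> Hu.
(* The upper limit is measurable on the whole line and agrees with the pointwise limit wherever the
   latter exists. *)
pose l t := fine (limn_esup (fun n => (u n t)%:E)).
have ml : measurable_fun [set: measurableTypeR R] l.
  apply: measurableT_comp => //; apply: measurable_fun_limn_esup => n.
  by apply/measurable_EFinP; exact: L2_measurable.
have lE : {ae mu, forall t, u n t @[n --> \oo] --> l t}.
  apply: filterS (geometric_ae_cvg Hu) => t /cvg_ex[x ux].
  have /cvg_limn_einf_sup[_ lx] : (u n t)%:E @[n --> \oo] --> x%:E.
    by apply: cvg_EFin => //; exact: nearW.
  by rewrite /l lx.
have key n : (\int[mu]_t ((l t - u n t) ^+ 2)%:E <= ((2 * 2^-1 ^+ n) ^+ 2)%:E)%E.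
  apply: (@fatou_ae_le _ _ mu (fun k t => (u (n + k)%N t - u n t) ^+ 2)).
  - move=> k; apply: measurable_funX; apply: measurable_funB; exact: L2_measurable.
  - by apply: measurable_funX; apply: measurable_funB => //; exact: L2_measurable.
  - by move=> k t; exact: sqr_ge0.
  - apply: filterS lE => t ut; rewrite expr2.
    under eq_fun do rewrite expr2.
    have H : u (n + k)%N t - u n t @[k --> \oo] --> l t - u n t.
      apply: cvgB; last exact: cvg_cst.
      under eq_fun do rewrite addnC.
      by move: ut; rewrite -(cvg_shiftn n (fun m => u m t)); exact.
    exact: cvgM.
  - move=> k; apply: (@le_trans _ _ (`|u (n + k)%N - u n| ^+ 2)%:E); last first.
      by rewrite lee_fin lerXn2r ?nnegrE ?mulr_ge0 ?exprn_ge0 ?invr_ge0// L2_geometric_dist.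
    rewrite norm_sqr /inner /Rintegral fineK; last first.
      by apply: integrable_fin_num => //; exact: inner_integrable.
    rewrite le_eqVlt; apply/orP; left; apply/eqP; apply: ae_eq_integral => //.
    + by apply/measurable_EFinP; apply: measurable_funX;
        apply: measurable_funB; exact: L2_measurable.
    + by apply/measurable_EFinP; apply: measurable_funM; exact: L2_measurable.
    + apply: filterS2 (L2_addE (u (n + k)%N) (- u n)) (L2_oppE (u n)) => t.
      by move=> /(_ I) -> /(_ I) -> _; rewrite expr2.
have Hd n : (fun t => l t - u n t) \in Lfun mu 2%:E.
  rewrite inE; apply/andP; split; rewrite inE/=.
    by apply: measurable_funB => //; exact: L2_measurable.
  rewrite /finite_norm unlock; apply: poweR_lty.
  apply: le_lt_trans (ltry ((2 * 2^-1 ^+ n) ^+ 2)); apply: le_trans (key n).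
  rewrite le_eqVlt; apply/orP; left; apply/eqP; apply: eq_integral => t _ /=.
  by rewrite powR_mulrn// real_normK ?num_real.
(* Square integrability is known for the differences l - u n, by Fatou's lemma in [key]; the limit
   class is assembled as (l - u 0) + u 0. *)
pose L := L2_of (Hd 0%N) + u 0%N.
exists L => n; rewrite -normrN opprB -ler_sqr ?nnegrE ?mulr_ge0 ?exprn_ge0 ?invr_ge0//.
rewrite norm_sqr.
have -> : L - u n = L2_of (Hd n).
  have LE : (L : R -> R) = l %[ae mu].
    apply: filterS2 (L2_addE (L2_of (Hd 0%N)) (u 0%N)) (L2_ofE (Hd 0%N)) => t.
    by move=> /(_ I) -> /(_ I) -> _; rewrite subrK.
  apply: L2_eq; apply: filterS3 (L2_addE L (- u n)) LE _.
    move=> t /(_ I) -> /(_ I) ->; exact.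
  apply: filterS2 (L2_oppE (u n)) (L2_ofE (Hd n)) => t.
  by move=> /(_ I) -> /(_ I) -> _.
rewrite (@inner_ae _ _ _ (fun t => l t - u n t) (fun t => l t - u n t));
  [|exact: Lfun2_measurable..|exact: L2_ofE|exact: L2_ofE].
rewrite -lee_fin /Rintegral fineK; last first.
  by apply: integrable_fin_num => //; exact: Lfun2_mul_integrable.
exact: key.
Qed.

End completeness.

(** * Test functions *)

Section test_functions.
Context {R : realType}.
Local Notation mu := (S1_measure R).
Local Notation leb := (@lebesgue_measure R).
Implicit Types phi psi : R -> R.

Lemma derivable_continuous (f : R -> R) :
  (forall t, derivable f t 1) -> continuous f.
Proof. by move=> df t; apply: differentiable_continuous; apply/derivable1_diffP. Qed.

Lemma test_function_deriv phi : test_function phi -> test_function (derive1 phi).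
Proof.
move=> [pphi dphi]; split.
  move=> t; rewrite /derive1.
  suff -> : (fun h => h^-1 *: (phi (h + (t + 1)) - phi (t + 1)) : R) =
            (fun h => h^-1 *: (phi (h + t) - phi t) : R) by [].
  by apply/funext => h; rewrite addrA !pphi.
by move=> n t; have := dphi n.+1 t; rewrite /derive1n iterSr.
Qed.

Lemma test_function_C_S1 phi : test_function phi -> C_S1 phi.
Proof.
by move=> [pphi dphi]; split => //; apply: derivable_continuous => t;
  exact: (dphi 0%N t).
Qed.

Lemma test_function_derivable phi t : test_function phi -> derivable phi t 1.
Proof. by move=> [_ dphi]; exact: (dphi 0%N t). Qed.

Lemma C_S1_Lfun (f : R -> R) : C_S1 f -> f \in Lfun mu 2%:E.
Proof.
move=> Cf; have [M fM] := C_S1_bounded Cf.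
apply: (@bounded_Lfun _ _ _ S1_prob _ M) => //.
by apply: continuous_measurable_fun; case: Cf.
Qed.

Lemma test_function_cst (a : R) : test_function (cst a).
Proof.
split=> // n t; case: n => [|n]; first exact: derivable_cst.
suff -> : derive1n n.+1 (cst a : R -> R) = cst 0 by exact: derivable_cst.
elim: n => [|n IH]; first by apply/funext => x; rewrite derive1n1 derive1_cst.
by apply/funext => x; rewrite derive1nS IH derive1_cst.
Qed.

Lemma derive1n_subc n phi (a : R) :
  (forall m t, derivable (derive1n m phi) t 1) ->
  derive1n n.+1 (fun t => phi t - a) = derive1n n.+1 phi.
Proof.
move=> dphi; elim: n => [|n IH].
  rewrite !derive1n1; apply/funext => t; rewrite !derive1E.
  rewrite deriveB//; last exact: (dphi 0%N t).
  by rewrite derive_cst subr0.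
by rewrite derive1nS IH -derive1nS.
Qed.

Lemma test_function_subc phi (a : R) : test_function phi ->
  test_function (fun t => phi t - a).
Proof.
move=> [pphi dphi]; split; first by move=> t; rewrite pphi.
case=> [|n] t; last by rewrite derive1n_subc.
by apply: derivableB; [exact: (dphi 0%N t)|exact: derivable_cst].
Qed.

Lemma integral_S1_FTC phi (s : R) : 0 <= s <= 1 -> test_function phi ->
  \int[leb]_(t in `[0, s]) derive1 phi t = phi s - phi 0.
Proof.
move=> /andP[s0 s1] Hphi; move: s0; rewrite le_eqVlt => /predU1P[<-|s0].
  by rewrite subrr set_itv1 Rintegral_set1.
have cphi := (test_function_C_S1 Hphi).1.
rewrite /Rintegral (@continuous_FTC2 _ _ phi)//.
- apply: continuous_subspaceT.
  exact: (test_function_C_S1 (test_function_deriv Hphi)).1.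
- split.
  + by move=> x _; exact: test_function_derivable.
  + by apply: cvg_at_right_filter; exact: cphi.
  + by apply: cvg_at_left_filter; exact: cphi.
Qed.

Section antiderivative.
Variable psi : R -> R.
Hypothesis cpsi : continuous psi.

(** The oriented integral of [psi] from 0 to t: an integral over a set carries no orientation, so
    negative t gets its own branch and sign. *)
Definition antideriv (t : R) : R :=
  if 0 <= t then \int[leb]_(s in `]0, t]) psi s
  else - \int[leb]_(s in `]t, 0]) psi s.

Let intpsi (a b : R) : leb.-integrable `[a, b] (EFin \o psi).
Proof.
apply: continuous_compact_integrable; first exact: segment_compact.
exact: continuous_subspaceT.
Qed.

Lemma antiderivE (M t : R) : M <= t -> M <= 0 ->
  antideriv t = \int[leb]_(s in `[M, t]) psi s - \int[leb]_(s in `[M, 0]) psi s.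
Proof.
move=> Mt M0; rewrite /antideriv; case: ifPn => [t0|].
  by rewrite Rintegral_itvB ?bnd_simp//; exact: intpsi.
rewrite -ltNge => t0.
by rewrite -opprB Rintegral_itvB ?bnd_simp ?(ltW t0)//; exact: intpsi.
Qed.

Lemma antideriv_derive (t : R) : is_derive t (1 : R) antideriv (psi t).
Proof.
(* A base point strictly below both t and 0 makes t interior to [M, t + 1], where the fundamental
   theorem applies; moving the base point changes the antiderivative by a constant. *)
pose M := Num.min t 0 - 1.
have Mt : M < t by rewrite ltrBlDr gt_min ltrDl ltr01.
have M0 : M <= 0 by rewrite lerBlDr ge_min add0r ler01 orbT.
pose G x := \int[leb]_(s in `[M, x]) psi s - \int[leb]_(s in `[M, 0]) psi s.
have dG : is_derive t (1 : R) G (psi t).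
  have [d1 d2] := @continuous_FTC1_closed R psi M t (t + 1)
    (ltr_pwDr ltr01 (lexx t)) (intpsi _ _) Mt (@cpsi t).
  rewrite -[X in is_derive _ _ _ X]subr0; apply: is_deriveB.
  by split => //; rewrite -derive1E.
have nG : {near t, G =1 antideriv}.
  near=> x; rewrite (@antiderivE M)//.
  by apply/ltW; near: x; exact: lt_nbhsr.
apply: DeriveDef; first by apply: near_eq_derivable nG _; case: dG.
by rewrite -(near_eq_derive _ nG); case: dG.
Unshelve. all: end_near. Qed.

End antiderivative.

(** Zero mean is what makes the antiderivative periodic: its increment over a period has derivative
    0 and equals the mean of [psi] at 0. *)
Lemma test_function_antideriv psi : test_function psi ->
  \int[leb]_(s in `[0, 1]) psi s = 0 ->
  test_function (antideriv psi) /\ derive1 (antideriv psi) = psi.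
Proof.
move=> Hpsi psi0; have cpsi := (test_function_C_S1 Hpsi).1.
have dA := antideriv_derive cpsi.
have dE : derive1 (antideriv psi) = psi.
  by apply/funext => t; rewrite derive1E; case: (dA t).
split => //; split.
  move=> t.
  have H x : is_derive x (1 : R) (fun x => antideriv psi (x + 1) - antideriv psi x) 0.
    have h1 : is_derive x (1 : R) (fun x => x + 1 : R) 1.
      by rewrite -[X in is_derive _ _ _ X]addr0; apply: is_deriveD.
    have h2 : is_derive (x + 1) (1 : R) (antideriv psi) (psi (x + 1)) := dA _.
    have h3 := is_derive1_comp (f := antideriv psi) (g := fun x => x + 1) h2 h1.
    have h4 := is_deriveB h3 (dA x).
    by move: h4; rewrite Hpsi.1 mulr1 subrr.
  have := is_derive_0_is_cst t 0 H; rewrite add0r.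
  rewrite (@antiderivE _ cpsi 0 1)// (@antiderivE _ cpsi 0 0)// psi0 subrr.
  by rewrite set_itv1 Rintegral_set1 !subr0 => /subr0_eq.
case=> [|n] t; first by case: (dA t).
by rewrite /derive1n iterSr dE; exact: Hpsi.2.
Qed.

Definition L2_test phi (H : test_function phi) : L2 R :=
  L2_of (C_S1_Lfun (test_function_C_S1 H)).

Lemma weak_derivP (u v : L2 R) : weak_deriv u v <->
  forall phi (H : test_function phi),
    inner u (L2_test (test_function_deriv H)) = - inner v (L2_test H).
Proof.
by split=> uv phi H; [rewrite !inner_ofr; exact: uv|
  have := uv phi H; rewrite !inner_ofr].
Qed.

Lemma weak_deriv_comb (a : R) (u v u' v' : L2 R) :
  weak_deriv u v -> weak_deriv u' v' ->
  weak_deriv (u + a *: u') (v + a *: v').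
Proof.
move=> /weak_derivP uv /weak_derivP uv'; apply/weak_derivP => phi H.
by rewrite !innerDl !innerZl uv uv' mulrN opprD.
Qed.

Lemma weak_deriv0 : weak_deriv (0 : L2 R) 0.
Proof. by apply/weak_derivP => phi H; rewrite !inner0l oppr0. Qed.

(** Pairing with a fixed test function is continuous, so the defining identity passes to the limit.
    The rates are those delivered by [L2_complete]. *)
Lemma weak_deriv_closed (u v : nat -> L2 R) (l m : L2 R) :
  (forall n, weak_deriv (u n) (v n)) ->
  (forall n, `|u n - l| <= 2 * 2^-1 ^+ n) ->
  (forall n, `|v n - m| <= 2 * 2^-1 ^+ n) -> weak_deriv l m.
Proof.
move=> uv ul vm; apply/weak_derivP => phi H; apply/eqP.
rewrite -subr_eq0 opprK -normr_eq0 eq_le normr_ge0 andbT.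
set p' := L2_test _; set p := L2_test H.
have key n : `|inner l p' + inner m p| <= (2 * (`|p'| + `|p|)) * 2^-1 ^+ n.
  have -> : inner l p' + inner m p = - (inner (u n - l) p' + inner (v n - m) p).
    by have /weak_derivP/(_ _ H) := uv n; rewrite !innerBl -/p -/p' => ->; ring.
  rewrite normrN; apply: le_trans (ler_normD _ _) _.
  rewrite (_ : 2 * (_ + _) * _ = 2 * 2^-1 ^+ n * `|p'| + 2 * 2^-1 ^+ n * `|p|); last by ring.
  apply: lerD; apply: le_trans (cauchy_schwarz _ _) _; exact: ler_wpM2r.
set B := 2 * _ in key.
have cB : (B * 2^-1 ^+ n) @[n --> \oo] --> B * 0.
  apply: cvgM; first exact: cvg_cst.
  by apply: cvg_expr; rewrite gtr0_norm ?invr_gt0// invf_lt1// ltr1n.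
by rewrite -(mulr0 B); apply: (cvgr_to_ge cB); apply: nearW.
Qed.

Lemma L2_test_deriv phi (H : test_function phi) :
  weak_deriv (L2_test H) (L2_test (test_function_deriv H)).
Proof.
apply/weak_derivP => psi H'.
rewrite !inner_ofr.
have c1 := test_function_C_S1 H; have c2 := test_function_C_S1 H'.
have c1' := test_function_C_S1 (test_function_deriv H).
have c2' := test_function_C_S1 (test_function_deriv H').
have E (a b : R -> R) (Ha : C_S1 a) (Hb : C_S1 b) :
    \int[mu]_t (L2_of (C_S1_Lfun Ha) t * b t) = \int[leb]_(t in `[0, 1]) (a t * b t).
  rewrite /Rintegral -integral_S1; last first.
    apply/measurable_EFinP; apply: measurable_funM;
      apply: continuous_measurable_fun; [exact: Ha.1|exact: Hb.1].
  apply: ae_eq_Rintegral.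
  - apply: measurable_funM; first exact: L2_measurable.
    by apply: continuous_measurable_fun; exact: Hb.1.
  - by apply: measurable_funM; apply: continuous_measurable_fun; [exact: Ha.1|exact: Hb.1].
  - by apply: filterS (L2_ofE (C_S1_Lfun Ha)) => t /(_ I) -> _.
rewrite !E//.
rewrite (@Rintegration_by_parts _ phi psi (derive1 phi))//.
- by rewrite -[1]add0r (H.1 0) (H'.1 0) subrr sub0r.
- exact: continuous_subspaceT c1'.1.
- split; first by move=> x _; exact: test_function_derivable.
  + by apply: cvg_at_right_filter; exact: c1.1.
  + by apply: cvg_at_left_filter; exact: c1.1.
- exact: continuous_subspaceT c2'.1.
- split; first by move=> x _; exact: test_function_derivable.
  + by apply: cvg_at_right_filter; exact: c2.1.
  + by apply: cvg_at_left_filter; exact: c2.1.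
Qed.

End test_functions.

(** * Primitives and integration by parts *)

Section primitive.
Context {R : realType}.
Local Notation mu := (S1_measure R).
Local Notation leb := (@lebesgue_measure R).
Implicit Types x y : R -> R.

(** The upper limit of integration is an indicator, so that measurability in t and integration by
    parts both become instances of Fubini on the product with kernel (s <= t). *)
Definition prim (x : R -> R) (t : R) : R := \int[mu]_s (x s * (s <= t)%R%:R).

Let TT := (measurableTypeR R * measurableTypeR R)%type.

Lemma integrable_mulr d (T : measurableType d) (m : {measure set T -> \bar R})
    (f : T -> R) (k : R) : m.-integrable setT (EFin \o f) ->
  m.-integrable setT (EFin \o (fun s => f s * k)).
Proof. by move=> /(integrableZr measurableT k); apply: eq_integrable. Qed.

Lemma integrable_mull d (T : measurableType d) (m : {measure set T -> \bar R})
    (f : T -> R) (k : R) : m.-integrable setT (EFin \o f) ->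
  m.-integrable setT (EFin \o (fun s => k * f s)).
Proof. by move=> /(integrableZl measurableT k); apply: eq_integrable. Qed.

Lemma measurable_le_pair :
  measurable_fun [set: TT] (fun z : TT => ((z.1 <= z.2)%R%:R : R)).
Proof.
have -> : (fun z : TT => ((z.1 <= z.2)%R%:R : R)) = \1_[set z : TT | z.1 <= z.2].
  by apply/funext => z; rewrite indicE; congr (nat_of_bool _)%:R;
    apply/idP/idP => [?|]; rewrite ?inE.
apply: measurable_indic.
have -> : [set z : TT | z.1 <= z.2] = (fun z : TT => z.2 - z.1) @^-1` `[0, +oo[.
  by apply/seteqP; split => z /=; rewrite in_itv/= andbT subr_ge0.
rewrite -[X in measurable X]setTI.
have : measurable_fun [set: TT] (fun z : TT => z.2 - z.1).
  by apply: measurable_funB; [exact: measurable_snd|exact: measurable_fst].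
by apply => //; exact: measurable_itv.
Qed.

Lemma measurable_le_ind (t : R) :
  measurable_fun [set: measurableTypeR R] (fun s => ((s <= t)%R%:R : R)).
Proof.
exact: (measurableT_comp measurable_le_pair (measurable_pair2 t)).
Qed.

Lemma integrable_le_ind x t : mu.-integrable setT (EFin \o x) ->
  mu.-integrable setT (EFin \o (fun s => x s * (s <= t)%R%:R)).
Proof.
move=> ix; have /integrableP[/measurable_EFinP mx _] := ix.
apply: (le_integrable measurableT _ _ ix).
  by apply/measurable_EFinP; apply: measurable_funM => //; exact: measurable_le_ind.
move=> s _ /=; rewrite lee_fin normrM ler_piMr//.
by case: (s <= t); rewrite ?normr1 ?normr0.
Qed.

(** Valid at every t: this is the source of the sup bound for H^1 functions. *)
Lemma prim_le x t : mu.-integrable setT (EFin \o x) ->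
  `|prim x t| <= \int[mu]_s `|x s|.
Proof.
move=> ix; apply: le_trans (le_normr_Rintegral measurableT (integrable_le_ind t ix)) _.
apply: le_Rintegral => //.
- exact: (integrable_norm (integrable_le_ind t ix)).
- exact: (integrable_norm ix).
- move=> s _; rewrite normrM ler_piMr//.
  by case: (s <= t); rewrite ?normr1 ?normr0.
Qed.

Section fubini.
Variables x y : R -> R.
Hypothesis ix : mu.-integrable setT (EFin \o x).
Hypothesis iy : mu.-integrable setT (EFin \o y).

Let H (z : TT) : \bar R := (x z.1 * y z.2 * (z.1 <= z.2)%R%:R)%:E.
Let mx : measurable_fun [set: measurableTypeR R] x.
Proof. by have /integrableP[/measurable_EFinP] := ix. Qed.
Let my : measurable_fun [set: measurableTypeR R] y.
Proof. by have /integrableP[/measurable_EFinP] := iy. Qed.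

Let mH : measurable_fun [set: TT] H.
Proof.
apply/measurable_EFinP; apply: measurable_funM; last exact: measurable_le_pair.
apply: measurable_funM.
  exact: (measurableT_comp mx (measurable_fst)).
exact: (measurableT_comp my (measurable_snd)).
Qed.

Let iH : (S1_prob \x S1_prob)%E.-integrable [set: TT] H.
Proof.
apply/(integrable12ltyP S1_prob S1_prob mH).
have Iy : (\int[mu]_t `|(y t)%:E| < +oo)%E by have /integrableP[_] := iy.
have Ix : (\int[mu]_t `|(x t)%:E| < +oo)%E by have /integrableP[_] := ix.
apply: (@le_lt_trans _ _ (\int[mu]_s (`|x s|%:E * \int[mu]_t `|(y t)%:E|))%E).
  apply: ge0_le_integral => //.
  - by move=> s _; exact: integral_ge0.
  - apply: (measurable_fun_fubini_tonelli_F (m2 := S1_prob) (fun z => `|H z|%E)) => //.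
    exact: (measurableT_comp _ mH).
  - apply: emeasurable_funM => //; apply/measurable_EFinP.
    exact: measurableT_comp.
  - move=> s _; rewrite -ge0_integralZl//; last exact/measurable_EFinP/measurableT_comp.
    apply: ge0_le_integral => //.
    + apply: measurableT_comp => //.
      exact: (measurableT_comp mH (measurable_pair1 s)).
    + apply: emeasurable_funM => //.
      by apply/measurable_EFinP; exact: measurableT_comp.
    + move=> t _ /=; rewrite lee_fin -normrM [leLHS]normrM ler_piMr//.
      by case: (s <= t); rewrite ?normr1 ?normr0.
rewrite ge0_integralZr//; last 2 first.
  by apply/measurable_EFinP; exact: measurableT_comp.
  exact: integral_ge0.
apply: lte_mul_pinfty => //; first exact: integral_ge0.
by rewrite ge0_fin_numE //; exact: integral_ge0.
Qed.

Let fubini_GE (t : R) :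
  (\int[mu]_s (H (s, t)) = (prim x t * y t)%:E)%E.
Proof.
rewrite /prim -RintegralZr//; last exact: integrable_le_ind.
rewrite /Rintegral fineK; last first.
  apply: integrable_fin_num => //.
  by apply: integrable_mulr; exact: integrable_le_ind.
by apply: eq_integral => s _; rewrite /H /= mulrAC.
Qed.

Let prim_ge (s : R) :
  \int[mu]_t (y t * (s <= t)%R%:R) = \int[mu]_t y t - prim y s.
Proof.
rewrite /prim -RintegralB//; last exact: integrable_le_ind.
apply: ae_eq_Rintegral.
- apply: measurable_funM => //.
  exact: (measurableT_comp measurable_le_pair (measurable_pair1 s)).
- by apply: measurable_funB => //; apply: measurable_funM => //; exact: measurable_le_ind.
(* The indicators of s <= t and t <= s add up to 1 except at the single point t = s, which is
   null. *)
- have : {ae mu, forall t, t <> s}.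
    apply: S1_ae; exists [set s]; split => //; first exact: lebesgue_measure_set1.
    by move=> t /= /contrapT.
  apply: filterS => t ts _; case: (ltgtP s t) => st.
  + by rewrite mulr1 mulr0 subr0.
  + by rewrite mulr0 mulr1 subrr.
  + by rewrite st in ts.
Qed.

Let fubini_FE (s : R) :
  (\int[mu]_t (H (s, t)) = (x s * (\int[mu]_t y t - prim y s))%:E)%E.
Proof.
have iys : mu.-integrable setT (EFin \o (fun t => y t * (s <= t)%R%:R)).
  apply: (le_integrable measurableT _ _ iy).
    apply/measurable_EFinP; apply: measurable_funM => //.
    exact: (measurableT_comp measurable_le_pair (measurable_pair1 s)).
  move=> t _ /=; rewrite lee_fin normrM ler_piMr//.
  by case: (s <= t); rewrite ?normr1 ?normr0.
rewrite -prim_ge -RintegralZl//.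
rewrite /Rintegral fineK; last first.
  by apply: integrable_fin_num => //; exact: integrable_mull.
by apply: eq_integral => t _; rewrite /H /= mulrA.
Qed.

Lemma measurable_primM :
  measurable_fun [set: measurableTypeR R] (fun t => prim x t * y t).
Proof.
apply/measurable_EFinP; rewrite (_ : EFin \o _ = fubini_G S1_prob H).
  exact: measurable_fubini_G iH.
by apply/funext => t; rewrite /fubini_G [RHS]fubini_GE.
Qed.

(** Integration by parts as an exchange of the order of integration over the triangle s <= t: the
    inner integral in t is the tail of y, that is, its total minus its primitive. *)
Lemma prim_fubini_sub :
  \int[mu]_t (prim x t * y t) = \int[mu]_t (x t * (\int[mu]_s y s - prim y t)).
Proof.
transitivity (fine (\int[S1_prob]_t \int[S1_prob]_s H (s, t))%E).
  by congr fine; apply: eq_integral => t _; rewrite [RHS]fubini_GE.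
rewrite -(Fubini iH).
by congr fine; apply: eq_integral => t _; rewrite [LHS]fubini_FE.
Qed.

End fubini.

Lemma measurable_prim x : mu.-integrable setT (EFin \o x) ->
  measurable_fun [set: measurableTypeR R] (prim x).
Proof.
move=> ix; rewrite (_ : prim x = fun t => prim x t * cst 1 t).
  apply: measurable_primM => //; exact: (@finite_measure_integrable_cst _ _ _ S1_prob).
by apply/funext => t; rewrite mulr1.
Qed.

Lemma prim_Lfun x : mu.-integrable setT (EFin \o x) -> prim x \in Lfun mu 2%:E.
Proof.
move=> ix; apply: (@bounded_Lfun _ _ _ S1_prob _ (\int[mu]_s `|x s|)).
  exact: measurable_prim.
by move=> t; exact: prim_le.
Qed.

Lemma prim_test phi (H : test_function phi) (t : R) : 0 <= t <= 1 ->
  prim (derive1 phi) t = phi t - phi 0.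
Proof.
move=> t01; rewrite -(integral_S1_FTC t01 H) /prim.
have mphi : measurable_fun [set: measurableTypeR R] (derive1 phi).
  apply: continuous_measurable_fun.
  exact: (test_function_C_S1 (test_function_deriv H)).1.
rewrite /Rintegral integral_S1; last first.
  by apply/measurable_EFinP; apply: measurable_funM => //; exact: measurable_le_ind.
congr fine; rewrite [RHS]integral_mkcond [LHS]integral_mkcond.
apply: eq_integral => s _; rewrite !patchE !mem_setE !in_itv/=.
case/andP: t01 => t0 t1; have [s0|s0] := leP 0 s => //=.
have [st|st] := leP s t; rewrite ?mulr1 ?mulr0 ?(le_trans st t1)//=.
by case: ifP.
Qed.

End primitive.

(** * Weak derivatives: uniqueness, integration by parts, sup bound *)

Section weak_derivatives.
Context {R : realType}.
Local Notation mu := (S1_measure R).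
Local Notation leb := (@lebesgue_measure R).

Definition test_separating := forall d : L2 R,
  (forall phi (H : test_function phi), inner d (L2_test H) = 0) -> d = 0.

(* A function d annihilated by all test functions satisfies both [calL d 0] and
   [calL 0 0], so single-valuedness of the inverse of [calL] forces d = 0. *)
Lemma inverse_operator_separating (a : R) (C : L2 R -> L2 R) :
  inverse_operator (scaled a (@calL R)) C -> test_separating.
Proof.
move=> HC d Hd.
have d0 : weak_deriv d 0.
  by apply/weak_derivP => phi H; rewrite inner0l oppr0 Hd.
have d1 : weak_deriv 0 d.
  by apply/weak_derivP => phi H; rewrite inner0l Hd oppr0.
transitivity (C 0).
  apply/esym/HC; exists 0; last by rewrite scaler0.
  by exists 0, d; split => //; rewrite addNr.
apply/HC; exists 0; last by rewrite scaler0.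
by exists 0, 0; split; [exact: weak_deriv0|exact: weak_deriv0|rewrite addNr].
Qed.

Hypothesis sep : test_separating.

Lemma weak_deriv_unique (u v v' : L2 R) :
  weak_deriv u v -> weak_deriv u v' -> v = v'.
Proof.
move=> /weak_derivP uv /weak_derivP uv'; apply/eqP; rewrite -subr_eq0; apply/eqP.
apply: sep => phi H; rewrite innerBl; apply/eqP; rewrite subr_eq0.
by rewrite -eqr_opp -uv -uv'.
Qed.

Lemma wderivE (u v : L2 R) : weak_deriv u v -> wderiv u = v.
Proof.
move=> uv; apply: (weak_deriv_unique _ uv).
by rewrite /wderiv; case: xgetP => [w -> //|/(_ v)].
Qed.

Definition L2_one : L2 R := L2_test (test_function_cst 1).

Lemma inner_one (f : L2 R) : inner f L2_one = \int[mu]_t f t.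
Proof.
by rewrite inner_ofr; apply: eq_Rintegral => t _; rewrite mulr1.
Qed.

Lemma weak_deriv_mean (u v : L2 R) : weak_deriv u v -> \int[mu]_t v t = 0.
Proof.
move=> /(_ _ (test_function_cst 1)) H; apply/eqP; rewrite -oppr_eq0; apply/eqP.
transitivity (- \int[mu]_t (v t * cst 1 t)).
  by congr (- _); apply: eq_Rintegral => t _; rewrite mulr1.
rewrite -H (_ : (fun t => _) = cst 0); first by rewrite Rintegral_cst// mul0r.
by apply/funext => t; rewrite derive1_cst mulr0.
Qed.

Let L2_int (f : L2 R) : mu.-integrable setT (EFin \o (f : R -> R)).
Proof. exact: Lfun2_integrable (L2_Lfun f). Qed.

Definition L2_prim (v : L2 R) : L2 R := L2_of (prim_Lfun (L2_int v)).

(** The primitives vanish at both ends of the period when the means are zero, so no boundary term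
    survives. *)
Lemma inner_L2_prim (v w : L2 R) : \int[mu]_t v t = 0 -> \int[mu]_t w t = 0 ->
  inner (L2_prim v) w = - inner v (L2_prim w).
Proof.
move=> v0 w0; rewrite inner_ofl prim_fubini_sub//; [|exact: L2_int..].
rewrite inner_ofr w0 -[RHS]mulN1r -RintegralZl//; last first.
  exact: Lfun2_mul_integrable (L2_Lfun _) (prim_Lfun (L2_int w)).
by apply: eq_Rintegral => t _; rewrite sub0r mulrN mulN1r.
Qed.

Lemma L2_prim_test phi (H : test_function phi) :
  L2_prim (L2_test (test_function_deriv H)) = L2_test H - phi 0 *: L2_one.
Proof.
apply: L2_eq; apply: ae_eq_trans (L2_ofE _) _.
have E t : prim (L2_test (test_function_deriv H)) t = prim (derive1 phi) t.
  apply: ae_eq_Rintegral.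
  - by apply: measurable_funM; [exact: L2_measurable|exact: measurable_le_ind].
  - apply: measurable_funM; last exact: measurable_le_ind.
    apply: continuous_measurable_fun.
    exact: (test_function_C_S1 (test_function_deriv H)).1.
  - apply: filterS (L2_ofE (C_S1_Lfun (test_function_C_S1 (test_function_deriv H)))) => s.
    by move=> /(_ I) -> _.
apply: filterS3 (L2_addE (L2_test H) (- (phi 0 *: L2_one)))
  (L2_oppE (phi 0 *: L2_one)) _.
  move=> t /(_ I) -> /(_ I) ->; exact.
apply: filterS3 (L2_scaleE (phi 0) L2_one) (L2_ofE (C_S1_Lfun (test_function_C_S1 H))) _.
  move=> t /(_ I) -> /(_ I) ->; exact.
(* [prim_test] speaks of points of [0, 1] only; these have full measure. *)
apply: filterS2 (L2_ofE (C_S1_Lfun (test_function_C_S1 (test_function_cst 1)))) S1_ae01 => t.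
move=> /(_ I) -> /= t01 _; rewrite mulr1 E (prim_test H)//.
Qed.

(** The du Bois-Reymond lemma: a test function minus its mean is the derivative of a test function,
    hence orthogonal to e. So e minus its mean is orthogonal to every test function, and these
    separate points. *)
Lemma weak_deriv_cst (e : L2 R) : weak_deriv e 0 ->
  e = (\int[mu]_t e t) *: L2_one.
Proof.
move=> /weak_derivP He; apply/eqP; rewrite -subr_eq0; apply/eqP; apply: sep => psi Hpsi.
set m := \int[leb]_(s in `[0, 1]) psi s.
have mpsi : measurable_fun [set: measurableTypeR R] psi.
  exact: continuous_measurable_fun (test_function_C_S1 Hpsi).1.
have mE : m = \int[mu]_s psi s.
  by rewrite /m /Rintegral integral_S1//; exact/measurable_EFinP.
have H0 := test_function_subc m Hpsi.
have ipsi : leb.-integrable `[0, 1] (EFin \o psi).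
  apply: continuous_compact_integrable; first exact: segment_compact.
  exact: continuous_subspaceT (test_function_C_S1 Hpsi).1.
have [|HA dA] := test_function_antideriv H0.
  rewrite RintegralB//; last first.
    apply: continuous_compact_integrable; first exact: segment_compact.
    by apply: continuous_subspaceT; exact: cst_continuous.
  rewrite Rintegral_cst//= lebesgue_measure_itv/= lte01 -EFinB subr0/= mulr1.
  by rewrite -/m subrr.
have E : L2_test (test_function_deriv HA) = L2_test Hpsi - m *: L2_one.
  apply: L2_eq; apply: ae_eq_trans (L2_ofE _) _; rewrite dA.
  apply: filterS3 (L2_addE (L2_test Hpsi) (- (m *: L2_one))) (L2_oppE (m *: L2_one)) _.
    move=> t /(_ I) -> /(_ I) ->; exact.
  apply: filterS3 (L2_scaleE m L2_one) (L2_ofE (C_S1_Lfun (test_function_C_S1 Hpsi))) _.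
    move=> t /(_ I) -> /(_ I) ->; exact.
  apply: filterS (L2_ofE (C_S1_Lfun (test_function_C_S1 (test_function_cst 1)))) => t.
  by move=> /(_ I) -> _; rewrite mulr1.
have := He _ HA; rewrite E inner0l oppr0 innerBr innerZr inner_one => H.
have -> : inner (e - (\int[mu]_t e t) *: L2_one) (L2_test Hpsi) =
   inner e (L2_test Hpsi) - (\int[mu]_t e t) * inner L2_one (L2_test Hpsi).
  by rewrite innerBl innerZl.
suff -> : inner L2_one (L2_test Hpsi) = m by rewrite mulrC.
rewrite innerC inner_one mE; apply: ae_eq_Rintegral => //.
  exact: L2_measurable.
exact: L2_ofE.
Qed.

(** The difference u - [L2_prim] v has weak derivative 0, because v has zero mean; it is therefore a
    constant. *)
Lemma weak_deriv_prim (u v : L2 R) : weak_deriv u v ->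
  exists a, u = L2_prim v + a *: L2_one.
Proof.
move=> uv; have v0 := weak_deriv_mean uv.
exists (\int[mu]_t (u - L2_prim v) t).
rewrite -weak_deriv_cst ?subrKC//.
apply/weak_derivP => phi H; move/weak_derivP : (uv) => /(_ _ H) E.
have d0 : \int[mu]_t (L2_test (test_function_deriv H)) t = 0.
  exact: weak_deriv_mean (L2_test_deriv H).
rewrite innerBl inner0l oppr0 E inner_L2_prim// L2_prim_test innerBr innerZr.
by rewrite inner_one v0; ring.
Qed.

(** The definition of [weak_deriv] allows only smooth factors on one side. Here both factors are in
    H^1: each is a primitive plus a constant, and the constants pair to 0 with derivatives. *)
Lemma weak_deriv_ibp (u u' w w' : L2 R) : weak_deriv u u' -> weak_deriv w w' ->
  inner u w' = - inner u' w.
Proof.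
move=> Hu Hw; have [a ->] := weak_deriv_prim Hu; have [b ->] := weak_deriv_prim Hw.
have u0 := weak_deriv_mean Hu; have w0 := weak_deriv_mean Hw.
rewrite innerDl innerZl innerDr innerZr (innerC L2_one) !inner_one u0 w0.
by rewrite inner_L2_prim//; ring.
Qed.

Lemma L2_one_norm : `|L2_one| = 1.
Proof.
apply/eqP; rewrite -(@eqrXn2 _ 2)// norm_sqr expr1n; apply/eqP.
rewrite (@inner_ae _ _ _ (fun=> 1) (fun=> 1)) //; [|exact: L2_ofE..].
by rewrite Rintegral_cst// mul1r mul1r S1_measure_setT.
Qed.

(** The embedding of H^1 into bounded functions. In u = prim v + a the primitive is at most |v|, and
    a is at most |u| + |v| as the norm of u - prim v. *)
Lemma weak_deriv_sup (u v : L2 R) : weak_deriv u v ->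
  {ae mu, forall t, `|u t| <= `|u| + 2 * `|v|}.
Proof.
move=> uv; have [a uE] := weak_deriv_prim uv.
have pv t : `|prim v t| <= `|v| by apply: le_trans (prim_le _ (L2_int v)) (inner_one_le v).
have npv : `|L2_prim v| <= `|v|.
  rewrite -ler_sqr ?nnegrE// norm_sqr.
  rewrite (@inner_ae _ _ _ (prim v) (prim v));
    [|exact: measurable_prim|exact: measurable_prim|exact: L2_ofE|exact: L2_ofE].
  apply: (@le_trans _ _ (\int[mu]_t (`|v| ^+ 2))); last first.
    by rewrite Rintegral_cst// S1_measure_setT mulr1.
  apply: le_Rintegral => //.
  - by apply: Lfun2_mul_integrable; apply: prim_Lfun.
  - exact: (@finite_measure_integrable_cst _ _ _ S1_prob).
  - move=> t _; rewrite -expr2 -[leLHS]real_normK ?num_real//.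
    by rewrite lerXn2r ?nnegrE.
have na : `|a| <= `|u| + `|v|.
  rewrite -[`|a|]mulr1 -L2_one_norm -normrZ.
  rewrite (_ : a *: _ = u - L2_prim v); last by rewrite uE addrAC subrr add0r.
  by apply: le_trans (ler_normB _ _) _; rewrite lerD2l.
have := L2_addE (L2_prim v) (a *: L2_one).
rewrite -uE => H.
apply: filterS3 H (L2_ofE (prim_Lfun (L2_int v))) _.
  move=> t /(_ I) -> /(_ I) ->; exact.
apply: filterS2 (L2_scaleE a L2_one)
  (L2_ofE (C_S1_Lfun (test_function_C_S1 (test_function_cst 1)))) => t.
move=> /(_ I) -> /(_ I) ->; rewrite mulr1.
apply: le_trans (ler_normD _ _) _; have := pv t; lra.
Qed.

End weak_derivatives.

(** * The covariance operator *)

Section covariance.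
Context {R : realType}.
Local Notation mu := (S1_measure R).
Variables (a : R) (C : L2 R -> L2 R).
Hypothesis a0 : 0 < a.
Hypothesis HC : inverse_operator (scaled a (@calL R)) C.

Let sep := inverse_operator_separating HC.

Lemma covarianceP (h : L2 R) : exists u' u'' : L2 R,
  [/\ weak_deriv (C h) u', weak_deriv u' u'' & h = a *: (- u'' + C h)].
Proof.
have [_ [u' [u'' [H1 H2 ->]]] hE] := (HC (C h) h).1 erefl.
by exists u', u''.
Qed.

Lemma covariance_sym (h k : L2 R) : inner (C h) k = inner h (C k).
Proof.
have [u' [u'' [H1 H2 Eh]]] := covarianceP h.
have [w' [w'' [H3 H4 Ek]]] := covarianceP k.
rewrite [in LHS]Ek [in RHS]Eh innerZr innerZl innerDr innerDl innerNr innerNl.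
rewrite (weak_deriv_ibp sep H1 H4) (innerC u'') (weak_deriv_ibp sep H3 H2).
by rewrite (innerC w').
Qed.

(** Linearity is not part of [inverse_operator]; it follows because the graph being inverted is
    linear and C is determined by it. *)
Lemma covariance_comb (s : R) (h k : L2 R) : C (h + s *: k) = C h + s *: C k.
Proof.
have [u' [u'' [H1 H2 Eh]]] := covarianceP h.
have [w' [w'' [H3 H4 Ek]]] := covarianceP k.
apply/HC; exists ((- u'' + C h) + s *: (- w'' + C k)).
  exists (u' + s *: w'), (u'' + s *: w''); split; try exact: weak_deriv_comb.
  by rewrite scalerDr scalerN opprD addrACA.
by rewrite [in LHS]Eh [in LHS]Ek !scalerDr !scalerA mulrC.
Qed.

Lemma covariance_ge0 (h : L2 R) : 0 <= inner (C h) h.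
Proof.
have [u' [u'' [H1 H2 Eh]]] := covarianceP h.
rewrite [in X in inner _ X]Eh innerZr innerDr innerNr (weak_deriv_ibp sep H1 H2) opprK.
by rewrite mulr_ge0 ?(ltW a0)// addr_ge0// inner_ge0.
Qed.

(** Let s be the H^1 norm of u = C h. Integration by parts gives <u, h> = a s^2, while |u| <= 3 s
    almost everywhere gives <u, h> <= 3 s |h|_1. Hence a s <= 3 |h|_1, and <u, h> = (a s)^2 / a. *)
Lemma covariance_le (h : L2 R) :
  inner (C h) h <= 9 / a * (\int[mu]_t `|h t|) ^+ 2.
Proof.
have [u' [u'' [H1 H2 Eh]]] := covarianceP h.
set u := C h in H1 Eh *; set H := \int[mu]_t _.
have qE : inner u h = a * (`|u'| ^+ 2 + `|u| ^+ 2).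
  by rewrite [in LHS]Eh innerZr innerDr innerNr (weak_deriv_ibp sep H1 H2) opprK !norm_sqr.
have H0 : 0 <= H by apply: Rintegral_ge0.
pose s := Num.sqrt (`|u'| ^+ 2 + `|u| ^+ 2).
have s2 : s ^+ 2 = `|u'| ^+ 2 + `|u| ^+ 2 by rewrite sqr_sqrtr// addr_ge0 ?sqr_ge0.
have s0 : 0 <= s by exact: sqrtr_ge0.
have su : `|u| <= s by rewrite -ler_sqr ?nnegrE// s2 lerDr sqr_ge0.
have su' : `|u'| <= s by rewrite -ler_sqr ?nnegrE// s2 lerDl sqr_ge0.
have ih : mu.-integrable setT (EFin \o (fun t => `|h t|)).
  exact: integrable_norm (Lfun2_integrable (L2_Lfun h)).
have q_le : inner u h <= 3 * s * H.
  rewrite /H -RintegralZl//.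
  rewrite /inner -subr_ge0 -RintegralB//; [|exact: integrable_mull|exact: inner_integrable].
  have -> : \int[mu]_t (3 * s * `|h t| - u t * h t) =
            \int[mu]_t `|3 * s * `|h t| - u t * h t|.
    have m1 : measurable_fun [set: measurableTypeR R] (fun t => 3 * s * `|h t| - u t * h t).
      apply: measurable_funB; last by apply: measurable_funM; exact: L2_measurable.
      by apply: measurable_funM => //; apply: measurableT_comp => //; exact: L2_measurable.
    apply: ae_eq_Rintegral => //; first exact: measurableT_comp.
    apply: filterS (weak_deriv_sup sep H1) => t ut _; apply/esym/ger0_norm; rewrite subr_ge0.
    apply: le_trans (ler_norm _) _; rewrite normrM ler_wpM2r//.
    by apply: le_trans ut _; lra.
  by apply: Rintegral_ge0 => t _.
move: q_le; rewrite qE -s2 => q_le.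
have as_le : a * s <= 3 * H.
  move: s0; rewrite le_eqVlt => /predU1P[<-|s0]; first by rewrite mulr0 mulr_ge0.
  by rewrite -(ler_pM2r s0); move: q_le; rewrite expr2 mulrA => /le_trans; apply; lra.
rewrite -(ler_pM2l a0) (_ : a * (9 / a * H ^+ 2) = (3 * H) ^+ 2); last first.
  by field; rewrite gt_eqF.
rewrite (_ : a * (a * s ^+ 2) = (a * s) ^+ 2); last by ring.
by rewrite lerXn2r// nnegrE; apply: mulr_ge0 => //; exact: ltW.
Qed.

End covariance.

(** * Averages over the cells of a partition *)

Section step_functions.
Context {R : realType}.
Local Notation mu := (S1_measure R).
Local Notation leb := (@lebesgue_measure R).

(** Half-open, so that the cells with z = 0, ..., n partition [0, 1) and leave out only the null
    point 1. The index is real to serve both ordinals and integer parts. *)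
Definition cell (n : nat) (z : R) : set R := `[z / n.+1%:R, (z + 1) / n.+1%:R[%classic.

Lemma measurable_cell n z : measurable (cell n z : set (measurableTypeR R)).
Proof. exact: measurable_itv. Qed.

Let cell_lt (n : nat) (z : R) : z / n.+1%:R < (z + 1) / n.+1%:R.
Proof. by rewrite ltr_pM2r ?invr_gt0 ?ltr0Sn// ltrDl. Qed.

Lemma leb_cell n z : leb (cell n z) = (n.+1%:R^-1)%:E.
Proof.
rewrite lebesgue_measure_itv/= lte_fin cell_lt -EFinB; congr EFin.
by rewrite -mulrBl addrAC subrr add0r mul1r.
Qed.

Lemma cellE n z x : cell n z x <-> z <= x * n.+1%:R < z + 1.
Proof.
rewrite /cell/= in_itv/= ler_pdivrMr ?ltr0Sn// ltr_pdivlMr ?ltr0Sn//.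
Qed.

Lemma cell_sub01 n (j : 'I_n.+1) : cell n j%:R `<=` `[0, 1].
Proof.
move=> x /cellE/andP[jx xj]; rewrite /= in_itv/=; apply/andP; split.
  by rewrite -(@pmulr_lge0 _ n.+1%:R) ?ltr0Sn//; apply: le_trans jx.
rewrite -(@ler_pM2r _ n.+1%:R) ?ltr0Sn// mul1r; apply: le_trans (ltW xj) _.
by rewrite natr1 ler_nat.
Qed.

Lemma cell_ind n (j : 'I_n.+1) x : 0 <= x < 1 ->
  \1_(cell n j%:R) x = (inord (Num.trunc (x * n.+1%:R)) == j)%:R :> R.
Proof.
move=> /andP[x0 x1]; rewrite indicE; congr (nat_of_bool _)%:R.
have x0' : 0 <= x * n.+1%:R by rewrite mulr_ge0.
have lt : (Num.trunc (x * n.+1%:R) < n.+1)%N.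
  by rewrite truncn_lt_nat// gtr_pMl// ltr0Sn.
rewrite -val_eqE/= inordK// truncn_eq//.
by apply/idP/idP; rewrite inE cellE natr1.
Qed.

Lemma cell_ind0 n (j : 'I_n.+1) x : ~~ (0 <= x < 1) -> \1_(cell n j%:R) x = 0 :> R.
Proof.
move=> x01; rewrite indicE memNset// => /cellE/andP[jx xj].
move/negP: x01; apply; apply/andP; split.
  by rewrite -(@pmulr_lge0 _ n.+1%:R) ?ltr0Sn//; apply: le_trans jx.
rewrite -(@ltr_pM2r _ n.+1%:R) ?ltr0Sn// mul1r; apply: lt_le_trans xj _.
by rewrite natr1 ler_nat.
Qed.

Lemma sum_cell n (F : 'I_n.+1 -> R) x :
  \sum_j F j * \1_(cell n j%:R) x =
  if 0 <= x < 1 then F (inord (Num.trunc (x * n.+1%:R))) else 0.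
Proof.
case: ifPn => x01; last by apply: big1 => j _; rewrite cell_ind0// mulr0.
rewrite (bigD1 (inord (Num.trunc (x * n.+1%:R))))//= cell_ind// eqxx mulr1.
rewrite big1 ?addr0// => j jn; rewrite cell_ind// eq_sym (negPf jn) mulr0//.
Qed.

Lemma cell_Lfun n z : (\1_(cell n z) : R -> R) \in Lfun mu 2%:E.
Proof.
apply: (@bounded_Lfun _ _ _ S1_prob _ 1).
  exact: measurable_indic (measurable_cell _ _).
by move=> x; rewrite indicE; case: (_ \in _); rewrite ?normr1 ?normr0.
Qed.

Definition L2_cell n (j : 'I_n.+1) : L2 R := L2_of (cell_Lfun n j%:R).

Lemma L2_cell_norm1 n (j : 'I_n.+1) : \int[mu]_t `|L2_cell j t| = n.+1%:R^-1.
Proof.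
transitivity (\int[mu]_t (\1_(cell n j%:R) t)).
  apply: ae_eq_Rintegral.
  - by apply: measurableT_comp => //; exact: L2_measurable.
  - exact: measurable_indic (measurable_cell _ _).
  - apply: filterS (L2_ofE (cell_Lfun n j%:R)) => t /(_ I) -> _.
    by rewrite ger0_norm.
rewrite /Rintegral integral_indic//; last exact: measurable_cell.
by rewrite setIT [X in fine X]S1_measureE ?leb_cell//; exact: cell_sub01.
Qed.

(** The squared norm of the orthogonal projection of f onto step functions: the cell indicators
    times the square root of n + 1 are orthonormal. *)
Definition cell_energy n (f : L2 R) : R :=
  \sum_(j < n.+1) n.+1%:R * inner f (L2_cell j) ^+ 2.

Definition cell_avg n (f : L2 R) (t : R) : R :=
  \sum_(j < n.+1) (n.+1%:R * inner f (L2_cell j)) * \1_(cell n j%:R) t.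

Lemma measurable_cell_avg n f : measurable_fun [set: measurableTypeR R] (cell_avg n f).
Proof.
apply: measurable_sum => j; apply: measurable_funM => //.
exact: measurable_indic (measurable_cell _ _).
Qed.

Lemma integral_cell_avg n f :
  (\int[mu]_t (cell_avg n f t ^+ 2)%:E = (cell_energy n f)%:E)%E.
Proof.
have E t : cell_avg n f t ^+ 2 =
    \sum_(j < n.+1) (n.+1%:R * inner f (L2_cell j)) ^+ 2 * \1_(cell n j%:R) t.
  by rewrite /cell_avg !sum_cell; case: ifP => // _; rewrite expr0n.
under eq_integral do rewrite E -sumEFin.
have ii (j : 'I_n.+1) : mu.-integrable setT
    (fun t => ((n.+1%:R * inner f (L2_cell j)) ^+ 2 * \1_(cell n j%:R) t)%:E).
  by apply: integrable_mull; exact: Lfun2_integrable (cell_Lfun _ _).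
rewrite integral_sum//.
rewrite /cell_energy -sumEFin; apply: eq_bigr => j _.
under eq_integral do rewrite EFinM.
rewrite integralZl//; last exact: Lfun2_integrable (cell_Lfun _ _).
rewrite integral_indic//; last exact: measurable_cell.
rewrite setIT [X in (_ * X)%E]S1_measureE; last exact: cell_sub01.
rewrite leb_cell -EFinM; congr EFin.
have : n.+1%:R != 0 :> R by rewrite pnatr_eq0.
by move: (inner f _) n.+1%:R => i N N0; field.
Qed.

Let Ecell (x : R) (n : nat) : set R := cell n (Num.floor (x * n.+1%:R))%:~R.

Let Ecell_nice x : nicely_shrinking x (Ecell x).
Proof.
split; first by move=> n; exact: measurable_cell.
have p0 n : 0 < 2 / n.+1%:R :> R by rewrite divr_gt0.
(* The cell containing x lies in the ball of radius 2 / (n + 1) around x, whose measure is 4 times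
   that of the cell. *)
exists (4, fun n => PosNum (p0 n)); split => //=.
- have : (2 : R) * n.+1%:R^-1 @[n --> \oo] --> (2 : R) * 0.
    by apply: cvgM; [exact: cvg_cst|exact: cvg_harmonic].
  by rewrite mulr0.
- move=> n y /cellE/andP[l u]; have /andP[l' u'] := floor_itv (x * n.+1%:R).
  rewrite intrD in u'; rewrite /ball/= ltr_pdivlMr ?ltr0Sn//.
  rewrite -[X in _ * X]gtr0_norm ?ltr0Sn// -normrM mulrBl.
  rewrite ltr_norml; apply/andP; split; lra.
- move=> n; rewrite lebesgue_measure_ball ?(ltW (p0 n))// leb_cell -EFinM lee_fin.
  by rewrite -mulr_natr; move: (n.+1%:R^-1) => N; lra.
Qed.

(** Lebesgue differentiation along the shrinking cells. The function is cut off outside [0, 1],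
    where nothing is known of a representative, and t = 1 is discarded because it lies in none of
    the summed cells. *)
Lemma cell_avg_cvg (f : L2 R) :
  {ae mu, forall t, cell_avg n f t @[n --> \oo] --> f t}.
Proof.
have mf := L2_measurable f.
have if01 : leb.-integrable `[0, 1] (EFin \o (f : R -> R)).
  have /integrableP[_ H] := Lfun2_integrable (L2_Lfun f).
  apply/integrableP; split; first exact/measurable_EFinP/measurable_funTS.
  rewrite -integral_S1//; apply/measurable_EFinP; exact: measurableT_comp.
have loc := integrable_locally (measurable_itv _) if01.
have t1 : {ae mu, forall t, t <> 1}.
  apply: S1_ae; exists [set 1]; split => //; first exact: lebesgue_measure_set1.
  by move=> t /= /contrapT.
apply: filterS3 S1_ae01 (S1_ae (lebesgue_differentiation loc)) t1 => t t01 pt tn1.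
have := nice_lebesgue_differentiation Ecell_nice loc pt.
have t01' : 0 <= t < 1.
  move: t01; rewrite /= in_itv/= => /andP[-> t1].
  by rewrite lt_neqAle t1 andbT; apply/eqP.
rewrite patchE mem_set// => H.
have : fine ((leb (Ecell t n))^-1 * \int[leb]_(y in Ecell t n) ((f \_ `[0%R, 1%R]) y)%:E)%E
    @[n --> \oo] --> f t by exact: fine_cvg H.
apply: cvg_trans; apply: near_eq_cvg; apply: nearW => n.
rewrite /cell_avg sum_cell t01'.
set j := inord _.
have tN0 : 0 <= t * n.+1%:R by rewrite mulr_ge0//; case/andP: t01'.
have lt : (Num.trunc (t * n.+1%:R) < n.+1)%N.
  by rewrite truncn_lt_nat// gtr_pMl ?ltr0Sn//; case/andP: t01'.
have Ej : Ecell t n = cell n j%:R.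
  rewrite /Ecell inordK// truncEfloor.
  have : 0 <= Num.floor (t * n.+1%:R) by rewrite floor_ge0.
  by case: (Num.floor _).
rewrite Ej leb_cell.
have -> : (\int[leb]_(y in cell n j%:R) ((f \_ `[0%R, 1%R]) y)%:E = (inner f (L2_cell j))%:E)%E.
  rewrite inner_ofr /Rintegral fineK; last first.
    apply: integrable_fin_num => //.
    exact: Lfun2_mul_integrable (L2_Lfun _) (cell_Lfun _ _).
  rewrite integral_S1; last first.
    apply/measurable_EFinP; apply: measurable_funM => //.
    exact: measurable_indic (measurable_cell _ _).
  rewrite [LHS]integral_mkcond [RHS]integral_mkcond; apply: eq_integral => s _.
  rewrite !patchE indicE; case: ifPn; case: ifPn => // _ _ ; rewrite ?mulr1 ?mulr0//.
by rewrite inver invr_eq0 pnatr_eq0/= invrK.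
Qed.

Lemma norm_le_cell_energy (f : L2 R) :
  ((`|f| ^+ 2)%:E <= limn_einf (fun n => (cell_energy n f)%:E))%E.
Proof.
rewrite norm_sqr /inner /Rintegral fineK; last first.
  by apply: integrable_fin_num => //; exact: inner_integrable.
have mE n : measurable_fun [set: measurableTypeR R] (fun t => (cell_avg n f t ^+ 2)%:E).
  by apply/measurable_EFinP; apply: measurable_funX; exact: measurable_cell_avg.
have -> : (fun n => (cell_energy n f)%:E) =
    (fun n => \int[mu]_t (cell_avg n f t ^+ 2)%:E)%E.
  by apply/funext => n; rewrite integral_cell_avg.
apply: le_trans (fatou mu measurableT mE _); last first.
  by move=> n t _; rewrite lee_fin sqr_ge0.
rewrite le_eqVlt; apply/orP; left; apply/eqP; apply: ae_eq_integral => //.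
- by apply/measurable_EFinP; apply: measurable_funM; exact: L2_measurable.
- rewrite /limn_einf; apply: (measurableT_comp (@oppe_measurable R setT)).
  apply: (@measurable_fun_limn_esup _ _ _ _ (fun n x => (- (cell_avg n f x ^+ 2)%:E)%E)) => n.
  exact: (measurableT_comp (@oppe_measurable R setT) (mE n)).
- apply: filterS (cell_avg_cvg f) => t ft _.
  have H : (cell_avg n f t ^+ 2)%:E @[n --> \oo] --> (f t * f t)%:E.
    apply: cvg_EFin; first exact: nearW.
    by under eq_fun do rewrite /= expr2; exact: cvgM.
  by have [-> _] := cvg_limn_einf_sup H.
Qed.

End step_functions.

(** * Gaussian measures *)

Section gaussian_line.
Context {R : realType}.
Local Notation leb := (@lebesgue_measure R).

(** The Radon-Nikodym derivative of the normal law agrees almost everywhere with [normal_pdf], since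
    both have the same integral over every measurable set. *)
Lemma ge0_integral_normal_prob (m s : R) (F : R -> \bar R) :
  measurable_fun [set: measurableTypeR R] F -> (forall x, 0 <= F x)%E ->
  (\int[normal_prob m s]_x F x = \int[leb]_x (F x * (normal_pdf m s x)%:E))%E.
Proof.
move=> mF F0; have dom := normal_prob_dominates m s.
rewrite -(Radon_Nikodym_SigmaFinite.change_of_variables dom)//.
have irn := Radon_Nikodym_SigmaFinite.f_integrable dom.
have mp : measurable_fun [set: measurableTypeR R] (EFin \o normal_pdf m s).
  by apply/measurable_EFinP; exact: measurable_normal_pdf.
apply: ae_eq_integral => //.
- by apply: emeasurable_funM => //; exact: (measurable_int leb).
- exact: emeasurable_funM.
- apply: filterS (integral_ae_eq measurableT irn mp _).
  + by move=> x /= /(_ I) ->.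
  + by move=> E _ mE; rewrite -Radon_Nikodym_SigmaFinite.f_integral.
Qed.

(** Completing the square: exp x times the density of mean 0 is exp (s^2 / 2) times the density of
    mean s^2. *)
Lemma normal_mgf (s : R) : s != 0 ->
  (\int[normal_prob 0 s]_x (expR x)%:E = (expR (s ^+ 2 / 2))%:E)%E.
Proof.
move=> s0; rewrite ge0_integral_normal_prob; last 2 first.
- by apply/measurable_EFinP; exact: measurable_expR.
- by move=> x; rewrite lee_fin expR_ge0.
transitivity (\int[leb]_x ((expR (s ^+ 2 / 2))%:E * (normal_pdf (s ^+ 2) s x)%:E))%E.
  apply: eq_integral => x _; rewrite -!EFinM; congr EFin.
  rewrite !normal_pdfE// mulrCA [RHS]mulrCA; congr (_ * _).
  rewrite /normal_fun -!expRD; congr expR.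
  by rewrite -mulr_natr; field.
rewrite integralZl//; last exact: integrable_normal_pdf.
by rewrite integral_normal_pdf mule1.
Qed.

End gaussian_line.

(** * Moments of tilted Gaussian measures on L2 *)

Section gaussian_L2.
Context {R : realType}.
Local Notation mu := (S1_measure R).

Lemma borel_continuous_measurable (F : L2 R -> R) : continuous F ->
  measurable_fun [set: Borel (L2 R)] (F : Borel (L2 R) -> R).
Proof.
move=> cF; apply: (measurability _ (RGenOpens.measurableE R)).
move=> _ [_ [a [b ->] <-]]; rewrite setTI.
apply: sub_sigma_algebra; move/continuousP: cF; apply.
exact: interval_open.
Qed.

(** For z >= 0, exp z is the square of exp (z / 2) >= z / 2, whence the factor 4. *)
Lemma sqr_le_expR (y : R) : y ^+ 2 <= 4 * (expR y + expR (- y)).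
Proof.
have H (z : R) : 0 <= z -> z ^+ 2 <= 4 * expR z.
  move=> z0; have e : expR z = expR (z / 2) ^+ 2.
    by rewrite expr2 -expRD; congr expR; lra.
  have := expR_ge1Dx (z / 2); rewrite e; set w := expR _ => Hw.
  have : z / 2 <= w by lra.
  move=> Hw2; have : 0 <= (w - z / 2) * (w + z / 2) by apply: mulr_ge0; lra.
  lra.
have := expR_gt0 y; have := expR_gt0 (- y).
have [y0|y0] := leP 0 y; first by have := H _ y0; lra.
by have := H (- y); rewrite oppr_ge0 sqrrN => /(_ (ltW y0)); lra.
Qed.

Variables (nu : probability (Borel (L2 R)) R) (a : R) (C : L2 R -> L2 R).
Hypothesis a0 : 0 < a.
Hypothesis HC : inverse_operator (scaled a (@calL R)) C.
Hypothesis Hnu : gaussian_measure nu 0 C.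

Let sep := inverse_operator_separating HC.
Let q h := inner (C h) h.

Lemma measurable_inner (h : L2 R) :
  measurable_fun [set: Borel (L2 R)] (fun f : Borel (L2 R) => inner (f : L2 R) h).
Proof. by apply: borel_continuous_measurable; exact: inner_continuous. Qed.

Lemma gaussian_mgf (h : L2 R) :
  (\int[nu]_f (expR (inner (f : L2 R) h))%:E = (expR (q h / 2))%:E)%E.
Proof.
pose X := fun f : Borel (L2 R) => inner (f : L2 R) h : measurableTypeR R.
pose mX : measurable_fun setT X := measurable_inner h.
pose X' : {mfun Borel (L2 R) >-> measurableTypeR R} := mfun_Sub (mem_set mX).
have mexp : measurable_fun [set: measurableTypeR R] (fun x : R => (expR x)%:E).
  by apply/measurable_EFinP; exact: measurable_expR.
transitivity (\int[pushforward nu X']_x (expR x)%:E)%E.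
  by rewrite ge0_integral_pushforward.
have q0 : 0 <= q h := covariance_ge0 a0 HC h.
have Hlaw A : measurable A -> pushforward nu X' A = gaussian_law 0 (q h) A.
  by move=> mA; have := Hnu h mA; rewrite inner0l.
(* For zero variance the law is the Dirac mass at 0, and both sides equal 1. *)
have [qh0|qh0] := eqVneq (q h) 0.
  rewrite (@eq_measure_integral _ _ _ _ (dirac (0 : measurableTypeR R))).
    by rewrite integral_dirac// diracT mul1e qh0 mul0r.
  by move=> A mA _; rewrite [LHS]Hlaw// /gaussian_law qh0 eqxx.
have s0 : Num.sqrt (q h) != 0 by rewrite sqrtr_eq0 -ltNge lt_neqAle eq_sym qh0.
rewrite (@eq_measure_integral _ _ _ _ (normal_prob 0 (Num.sqrt (q h)))).
  by rewrite normal_mgf// sqr_sqrtr.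
by move=> A mA _; rewrite [LHS]Hlaw// /gaussian_law (negPf qh0).
Qed.

Lemma covariance_quad (s : R) (h k : L2 R) :
  q (h + s *: k) = q h + 2 * s * inner (C h) k + s ^+ 2 * q k.
Proof.
rewrite /q (covariance_comb HC) innerDl !innerDr !innerZl !innerZr.
by rewrite (innerC (C k) h) -(covariance_sym HC h k); ring.
Qed.

(* The tilted measure exp <f, h> nu is the Gaussian measure with mean C h; its
   second moments are read off the moment generating function of nu, without
   the Cameron-Martin theorem. *)
Lemma tilted_second_moment (h k : L2 R) (B : R) : 0 < B -> q k <= B ->
  (\int[nu]_f ((inner (f : L2 R) k - inner (C h) k) ^+ 2 * expR (inner (f : L2 R) h))%:E <=
   (8 * expR (2^-1) * B * expR (q h / 2))%:E)%E.
Proof.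
(* With s^2 = 1 / B one has s^2 q k <= 1, so each moment generating function at h + s k and h - s k,
   recentred by m, exceeds the one at h by at most the factor exp (1/2). The constant 8 is twice the
   4 of [sqr_le_expR]. A bound B > 0 replaces q k, which may vanish. *)
move=> B0 kB; pose s := (Num.sqrt B)^-1; pose m := inner (C h) k.
have s2 : s ^+ 2 = B^-1 by rewrite exprVn sqr_sqrtr// ltW.
pose G (f : L2 R) := 4 * B * expR (- (s * m)) * expR (inner f (h + s *: k)).
pose G' (f : L2 R) := 4 * B * expR (s * m) * expR (inner f (h + (- s) *: k)).
have mE (l : L2 R) : measurable_fun [set: Borel (L2 R)]
    (fun f : Borel (L2 R) => expR (inner (f : L2 R) l)).
  exact: (measurableT_comp (@measurable_expR R) (measurable_inner l)).
have mG : measurable_fun [set: Borel (L2 R)] (fun f : Borel (L2 R) => (G f)%:E).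
  by apply/measurable_EFinP; apply: measurable_funM => //; exact: mE.
have mG' : measurable_fun [set: Borel (L2 R)] (fun f : Borel (L2 R) => (G' f)%:E).
  by apply/measurable_EFinP; apply: measurable_funM => //; exact: mE.
have B0' : 0 <= B by exact: ltW.
have G0 f : (0 <= (G f)%:E)%E by rewrite lee_fin !mulr_ge0 ?expR_ge0.
have G'0 f : (0 <= (G' f)%:E)%E by rewrite lee_fin !mulr_ge0 ?expR_ge0.
apply: (@le_trans _ _ (\int[nu]_f ((G f)%:E + (G' f)%:E))%E).
  apply: ge0_le_integral; first exact: measurableT.
  - by move=> f _; rewrite lee_fin mulr_ge0 ?sqr_ge0 ?expR_ge0.
  - apply/measurable_EFinP; apply: measurable_funM => //.
    by apply: measurable_funX; apply: measurable_funB => //; exact: measurable_inner.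
  - exact: (emeasurable_funD mG mG').
  - move=> f _; rewrite -EFinD lee_fin.
    pose y := s * (inner (f : L2 R) k - m).
    have -> : (inner (f : L2 R) k - inner (C h) k) ^+ 2 = B * y ^+ 2.
      by rewrite exprMn s2 mulrA divff ?mul1r// gt_eqF.
    have -> : G f + G' f = B * (4 * (expR y + expR (- y))) * expR (inner (f : L2 R) h).
      rewrite /G /G' !innerDr !innerZr !expRD.
      have -> : expR y = expR (- (s * m)) * expR (s * inner (f : L2 R) k).
        by rewrite -expRD; congr expR; rewrite /y; ring.
      have -> : expR (- y) = expR (s * m) * expR (- s * inner (f : L2 R) k).
        by rewrite -expRD; congr expR; rewrite /y; ring.
      by move: (expR _) (expR _) (expR _) (expR _) (expR _) => e1 e2 e3 e4 e5; ring.
    by rewrite ler_wpM2r ?expR_ge0// ler_wpM2l ?(ltW B0)// sqr_le_expR.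
have intE (r : R) (l : L2 R) : 0 <= r ->
    (\int[nu]_f (r * expR (inner (f : L2 R) l))%:E = (r * expR (q l / 2))%:E)%E.
  move=> r0; under eq_integral do rewrite EFinM.
  rewrite ge0_integralZl//; first by rewrite gaussian_mgf -EFinM.
  by apply/measurable_EFinP; exact: mE.
have k1 : 0 <= 4 * B * expR (- (s * m)) by rewrite !mulr_ge0 ?expR_ge0.
have k2 : 0 <= 4 * B * expR (s * m) by rewrite !mulr_ge0 ?expR_ge0.
have IG : (\int[nu]_f (G f)%:E)%E = _ := intE _ _ k1.
have IG' : (\int[nu]_f (G' f)%:E)%E = _ := intE _ _ k2.
have IGG : (\int[nu]_f ((G f)%:E + (G' f)%:E) =
    \int[nu]_f (G f)%:E + \int[nu]_f (G' f)%:E)%E.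
  exact: (ge0_integralD nu measurableT (fun f _ => G0 f) mG (fun f _ => G'0 f) mG').
clearbody G G'.
rewrite IGG.
rewrite IG.
rewrite IG'.
rewrite -EFinD lee_fin !covariance_quad.
have E1 : expR (- (s * m)) * expR ((q h + 2 * s * m + s ^+ 2 * q k) / 2) =
    expR (q h / 2) * expR (s ^+ 2 * q k / 2).
  by rewrite -!expRD; congr expR; lra.
have E2 : expR (s * m) * expR ((q h + 2 * (- s) * m + (- s) ^+ 2 * q k) / 2) =
    expR (q h / 2) * expR (s ^+ 2 * q k / 2).
  by rewrite -!expRD sqrrN; congr expR; lra.
rewrite -/m -[X in X + _ <= _]mulrA E1 -[X in _ + X <= _]mulrA E2.
have : expR (s ^+ 2 * q k / 2) <= expR (2^-1).
  rewrite ler_expR s2 ler_pdivrMr// mulVf// ler_pdivrMl// mulr1//.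
set e := expR (_ / 2); set e' := expR (2^-1); set x := expR _ => xe.
have x0 : 0 <= x by exact: expR_ge0.
have : B * (x * e) <= B * (x * e') by rewrite ler_pM2l// ler_wpM2l.
lra.
Qed.

Lemma cell_energyZ n (c : R) (f : L2 R) :
  cell_energy n (c *: f) = c ^+ 2 * cell_energy n f.
Proof.
by rewrite /cell_energy mulr_sumr; apply: eq_bigr => j _; rewrite innerZl; ring.
Qed.

(** Each of the n + 1 cells has weight n + 1 and, having L^1 norm 1 / (n + 1), variance at most 9 /
    (a (n + 1)^2); the sum does not depend on n. The constant is 72 = 8 * 9. *)
Lemma tilted_norm_moment (h : L2 R) :
  (\int[nu]_f (`|(f : L2 R) - C h| ^+ 2 * expR (inner (f : L2 R) h))%:E <=
   (72 * expR (2^-1) / a * expR (q h / 2))%:E)%E.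
Proof.
pose E n (f : Borel (L2 R)) : R :=
  expR (inner (f : L2 R) h) * cell_energy n ((f : L2 R) - C h).
have mE n : measurable_fun [set: Borel (L2 R)] (fun f : Borel (L2 R) => (E n f)%:E).
  apply/measurable_EFinP; apply: measurable_funM.
    exact: (measurableT_comp (@measurable_expR R) (measurable_inner h)).
  apply: measurable_sum => j; apply: measurable_funM => //.
  apply: measurable_funX; under eq_fun do rewrite innerBl.
  by apply: measurable_funB => //; exact: measurable_inner.
have E0 n f : 0 <= E n f.
  by rewrite mulr_ge0 ?expR_ge0//; apply: sumr_ge0 => j _; rewrite mulr_ge0 ?sqr_ge0.
have mN : measurable_fun [set: Borel (L2 R)]
    (fun f : Borel (L2 R) => (`|(f : L2 R) - C h| ^+ 2 * expR (inner (f : L2 R) h))%:E).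
  apply/measurable_EFinP; apply: measurable_funM.
    apply: measurable_funX; apply: borel_continuous_measurable.
    apply/L2_continuousP => f e e0; exists e => // g fg.
    apply: le_lt_trans fg; apply: le_trans (ler_dist_dist _ _) _.
    by rewrite opprB addrA subrK.
  exact: (measurableT_comp (@measurable_expR R) (measurable_inner h)).
apply: (@le_trans _ _ (\int[nu]_f limn_einf (fun n => (E n f)%:E))%E).
  apply: ge0_le_integral; first exact: measurableT.
  - by move=> f _; rewrite lee_fin mulr_ge0 ?sqr_ge0 ?expR_ge0.
  - exact: mN.
  - rewrite /limn_einf; apply: (measurableT_comp (@oppe_measurable R setT)).
    apply: (@measurable_fun_limn_esup _ _ _ _ (fun n x => (- (E n x)%:E)%E)) => n.
    exact: (measurableT_comp (@oppe_measurable R setT) (mE n)).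
  (* Rescaling f - C h by the square root of the weight moves the weight inside the quadratic
     [cell_energy], so that [norm_le_cell_energy] applies as it stands. *)
  - move=> f _; pose c := expR (inner (f : L2 R) h / 2).
    have c2 : c ^+ 2 = expR (inner (f : L2 R) h).
      by rewrite expr2 -expRD; congr expR; lra.
    have := norm_le_cell_energy (c *: ((f : L2 R) - C h)).
    rewrite normrZ exprMn real_normK ?num_real// c2 mulrC.
    by under eq_fun do rewrite cell_energyZ c2.
apply: le_trans (fatou nu measurableT mE _) _.
  by move=> n f _; rewrite lee_fin.
apply: limn_einf_le => n.
have B0 : 0 < 9 / a * (n.+1%:R^-1) ^+ 2 by rewrite mulr_gt0 ?divr_gt0// exprn_gt0// invr_gt0.
pose F (j : 'I_n.+1) (f : Borel (L2 R)) : R :=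
  (inner (f : L2 R) (L2_cell j) - inner (C h) (L2_cell j)) ^+ 2 * expR (inner (f : L2 R) h).
have EE f : (E n f)%:E = (\sum_(j < n.+1) (n.+1%:R)%:E * (F j f)%:E)%E.
  rewrite /E /cell_energy mulr_sumr -sumEFin; apply: eq_bigr => j _.
  by rewrite -EFinM innerBl; congr EFin; rewrite /F; ring.
have mF j : measurable_fun [set: Borel (L2 R)] (fun f => (F j f)%:E).
  apply/measurable_EFinP; apply: measurable_funM.
    by apply: measurable_funX; apply: measurable_funB => //; exact: measurable_inner.
  exact: (measurableT_comp (@measurable_expR R) (measurable_inner h)).
have F0 j f : (0 <= (F j f)%:E)%E by rewrite lee_fin mulr_ge0 ?sqr_ge0 ?expR_ge0.
under eq_integral do rewrite EE.
rewrite ge0_integral_sum//; last 2 first.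
  by move=> j; apply: emeasurable_funM.
  by move=> j f _; rewrite mule_ge0// lee_fin.
apply: (@le_trans _ _ (\sum_(j < n.+1) (n.+1%:R)%:E *
    (8 * expR (2^-1) * (9 / a * (n.+1%:R^-1) ^+ 2) * expR (q h / 2))%:E)%E).
  apply: lee_sum => j _; rewrite ge0_integralZl// ?lee_fin//.
  apply: lee_wpmul2l; first by rewrite lee_fin.
  apply: tilted_second_moment => //.
  by have := covariance_le a0 HC (L2_cell j); rewrite L2_cell_norm1.
under eq_bigr do rewrite -EFinM.
rewrite sumEFin lee_fin sumr_const card_ord -[leLHS]mulr_natl.
rewrite le_eqVlt; apply/orP; left; apply/eqP.
have : n.+1%:R != 0 :> R by rewrite pnatr_eq0.
move: (expR _) (expR _) n.+1%:R => x y N N0; field.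
by rewrite N0 gt_eqF.
Qed.

End gaussian_L2.

(** * The functional Psi *)

Section taylor.
Context {R : realType}.

(** The mean value theorem twice. The factor th is not the s^2 / 2 of Taylor's formula, but 0 <= th
    <= s^2 suffices for both the sign and the size of the remainder, with no continuity of [ddphi]
    required. *)
Lemma second_order_mvt (phi dphi ddphi : R -> R) (p s : R) :
  (forall x, is_derive x (1 : R) phi (dphi x)) ->
  (forall x, is_derive x (1 : R) dphi (ddphi x)) ->
  exists e th, [/\ 0 <= th <= s ^+ 2, `|e - p| <= `|s| &
    phi (p + s) - phi p - dphi p * s = ddphi e * th].
Proof.
move=> d1 d2.
have mvt (f df : R -> R) (x y : R) : (forall z, is_derive z (1 : R) f (df z)) -> x < y ->
    exists2 z, x < z < y & f y - f x = df z * (y - x).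
  move=> dz xy; have cf : {within `[x, y], continuous f}.
    by apply: derivable_within_continuous => z _; case: (dz z).
  have [z] := MVT xy (fun z _ => dz z) cf.
  by rewrite in_itv/= => zxy E; exists z.
have [s0|s0|<-] := ltrgtP 0 s; last first.
- by exists p, 0; split; rewrite ?lexx ?sqr_ge0 ?subrr ?normr0// addr0 subrr !mulr0 subrr.
- have [x /andP[x1 x2] Ex] := mvt _ _ (p + s) p d1 ltac:(lra).
  have [e /andP[e1 e2] Ee] := mvt _ _ x p d2 x2.
  exists e, ((x - p) * s); split.
  + apply/andP; split; first by rewrite -mulrNN mulr_ge0//; lra.
    by rewrite -mulrNN expr2 -[s * s]mulrNN ler_wpM2r//; lra.
  + by rewrite ler0_norm ?(ltr0_norm s0); lra.
  + have -> : phi (p + s) - phi p = dphi x * s.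
      by rewrite -[LHS]opprK opprB Ex; ring.
    by rewrite -mulrBl -[dphi x - _]opprK opprB Ee; ring.
- have [x /andP[x1 x2] Ex] := mvt _ _ p (p + s) d1 ltac:(lra).
  have [e /andP[e1 e2] Ee] := mvt _ _ p x d2 x1.
  exists e, ((x - p) * s); split.
  + apply/andP; split; first by rewrite mulr_ge0//; lra.
    by rewrite expr2 ler_wpM2r//; lra.
  + by rewrite ger0_norm ?(gtr0_norm s0); lra.
  + have -> : phi (p + s) - phi p = dphi x * s by rewrite Ex; ring.
    by rewrite -mulrBl Ee; ring.
Qed.

End taylor.

(** * Gradient of Psi and its first-order bounds *)

Section potential.
Context {R : realType}.
Local Notation mu := (S1_measure R).
Variables (g : R -> R) (Phi : R -> R -> R -> R) (K : {linear L2 R -> (R -> R)}).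
Variables (h0 c : R).
Hypothesis Phi_periodic : forall p v, periodic (Phi p v) 1.
Hypothesis A2 : assumption_A2 g K.
Hypothesis A3 : assumption_A3 g Phi h0 c.
Hypothesis A4 : assumption_A4 Phi.

Let phi3 (z : R * R * R) : R := Phi z.1.1 z.1.2 z.2.

Let phi3_continuous : continuous phi3.
Proof.
have [lip _ _ _] := A4; move=> z; have [M HM] := lip z.
have : \forall x \near z, `|phi3 x - phi3 z| <= M * `|x - z|.
  case: HM => -[U V] [/= HU HV] UV.
  apply: filterS HU => x Ux.
  by apply: (UV (x, z)); split => //=; exact: nbhs_singleton.
move=> H; apply/cvgrPdist_lt => e e0.
have d0 : 0 < e / (`|M| + 1) by rewrite divr_gt0// ltr_wpDl.
near=> x; rewrite distrC; apply: (@le_lt_trans _ _ (M * `|x - z|)); first by near: x.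
have : `|z - x| < e / (`|M| + 1).
  by near: x; apply: (@cvgr_dist_lt _ _ _ _ _ id) => //; exact: cvg_id.
rewrite ltr_pdivlMr ?ltr_wpDl// distrC => Hx.
apply: le_lt_trans Hx; rewrite mulrC ler_wpM2l//.
by apply: le_trans (ler_norm _) _; rewrite lerDl.
Unshelve. all: end_near. Qed.

Let g_C : C_S1 g. Proof. by case: A2. Qed.
Let K_C f : C_S1 (K f). Proof. by case: A2 => -[]. Qed.

Let along (F : R -> R -> R -> R) (f : L2 R) (t : R) : R := F (K f t) (g t) t.

Let along_C (F : R -> R -> R -> R) f :
  continuous (fun z : R * R * R => F z.1.1 z.1.2 z.2) ->
  (forall p v, periodic (F p v) 1) -> C_S1 (along F f).
Proof.
move=> cF pF; split; last first.
  by move=> t; rewrite /along pF (K_C f).2 g_C.2.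
move=> t; apply: (@continuous_comp _ _ _ (fun t => (K f t, g t, t))
  (fun z : R * R * R => F z.1.1 z.1.2 z.2)); last exact: cF.
have Kg : (K f s, g s) @[s --> t] --> (nbhs (K f t), nbhs (g t)).
  by apply: cvg_pair; [exact: (K_C f).1|exact: g_C.1].
have Kg' : (fun s => (K f s, g s)) @ t --> nbhs ((K f t, g t) : R * R) by exact: Kg.
have idt : (fun s : R => s) @ t --> nbhs t by exact: cvg_id.
exact: (@cvg_pair R (R * R)%type R (nbhs t) (nbhs ((K f t, g t) : R * R)) (nbhs t)
  (nbhs_filter t) (nbhs_filter _) (nbhs_filter t) _ _ Kg' idt).
Qed.

Let d1_periodic n p v : periodic (d1 Phi n p v) 1.
Proof.
move=> t; rewrite /d1; congr (derive1n n _ p).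
by apply/funext => x; rewrite Phi_periodic.
Qed.

Let d1_0 p v t : is_derive p (1 : R) (fun x => Phi x v t) (d1 Phi 1 p v t).
Proof.
have [_ /(_ p v t)[H _] _ _] := A4; split; first exact: H.
by rewrite /d1 derive1n1 derive1E.
Qed.

Let d1_1 p v t : is_derive p (1 : R) (fun x => d1 Phi 1 x v t) (d1 Phi 2 p v t).
Proof.
have [_ /(_ p v t)[_ H] _ _] := A4; split; first exact: H.
by rewrite -derive1E.
Qed.

Let Phi_C f : C_S1 (along Phi f).
Proof. exact: along_C. Qed.

Let dPhi_C f : C_S1 (along (d1 Phi 1) f).
Proof. by apply: along_C => //; case: A4. Qed.

Let C_int (f : R -> R) : C_S1 f -> mu.-integrable setT (EFin \o f).
Proof. by move=> Hf; exact: Lfun2_integrable (C_S1_Lfun Hf). Qed.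

Let C_mul (f h : R -> R) : C_S1 f -> C_S1 h ->
  mu.-integrable setT (EFin \o (fun t => f t * h t)).
Proof. by move=> Hf Hh; exact: Lfun2_mul_integrable (C_S1_Lfun Hf) (C_S1_Lfun Hh). Qed.

Let int_add (f h : R -> R) : mu.-integrable setT (EFin \o f) ->
  mu.-integrable setT (EFin \o h) -> mu.-integrable setT (EFin \o (fun t => f t + h t)).
Proof. by move=> If Ih; have := integrableD measurableT If Ih; apply: eq_integrable. Qed.

Let int_sub (f h : R -> R) : mu.-integrable setT (EFin \o f) ->
  mu.-integrable setT (EFin \o h) -> mu.-integrable setT (EFin \o (fun t => f t - h t)).
Proof. by move=> If Ih; have := integrableB measurableT If Ih; apply: eq_integrable. Qed.

Let int_le_sup (F : R -> R) (B : R) : mu.-integrable setT (EFin \o F) ->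
  (forall t, F t <= B) -> \int[mu]_t F t <= B.
Proof.
move=> iF FB; apply: (@le_trans _ _ (\int[mu]_t B)); last first.
  by rewrite Rintegral_cst// S1_measure_setT mulr1.
apply: le_Rintegral => //.
exact: (@finite_measure_integrable_cst _ _ _ S1_prob).
Qed.

Lemma Psi_ge f : - c <= Psi g Phi K f.
Proof.
rewrite -lerN2 opprK /Psi -mulN1r -RintegralZl//; last exact: C_int (Phi_C f).
apply: int_le_sup.
  exact: (integrable_mull (-1) (C_int (Phi_C f))).
move=> t; have [h0_gt0 _ /(_ (K f t) t 0)] := A3.
by rewrite normr0 addr0 => /(_ (ltW h0_gt0))[H _]; lra.
Qed.

(** The remainder is the integral of a second derivative times a factor between 0 and (K v t)^2. It
    is nonnegative by (A3), and quadratic in |v| because K is bounded from L2 into the sup norm. *)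
Lemma Psi_gradient : exists grad : L2 R -> L2 R, forall u : L2 R,
  (forall v, Psi g Phi K u + inner (grad u) v <= Psi g Phi K (u + v)) /\
  exists2 M : R, 0 <= M & forall v, `|v| <= 1 ->
    Psi g Phi K (u + v) <= Psi g Phi K u + inner (grad u) v + M * `|v| ^+ 2.
Proof.
have [[_ [MK0 HMK0]] [Ks adj [KsC _]] _] := A2.
pose MK := `|MK0|; have MK_ge0 : 0 <= MK by exact: normr_ge0.
have HMK f t : `|K f t| <= MK * `|f|.
  by apply: le_trans (HMK0 f t) _; rewrite ler_wpM2r// ler_norm.
(* Chain rule: the adjoint of K applied to the first derivative of Phi along K u. *)
pose grad u : L2 R := L2_of (C_S1_Lfun (KsC (L2_of (C_S1_Lfun (dPhi_C u))))).
have gradE u v : inner (grad u) v = \int[mu]_t (along (d1 Phi 1) u t * K v t).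
  rewrite innerC inner_ofr -adj; apply: ae_eq_Rintegral.
  - apply: measurable_funM; last exact: L2_measurable.
    by apply: continuous_measurable_fun; exact: (K_C v).1.
  - by apply: measurable_funM; apply: continuous_measurable_fun;
      [exact: (dPhi_C u).1|exact: (K_C v).1].
  - apply: filterS (L2_ofE (C_S1_Lfun (dPhi_C u))) => t /(_ I) -> _.
    by rewrite mulrC.
have KD u v t : K (u + v) t = K u t + K v t by rewrite linearD.
have remE u v : Psi g Phi K (u + v) - (Psi g Phi K u + inner (grad u) v) =
    \int[mu]_t (along Phi (u + v) t - (along Phi u t + along (d1 Phi 1) u t * K v t)).
  rewrite gradE /Psi -RintegralD//; [|exact: C_int (Phi_C u)|exact: C_mul].
  rewrite -RintegralB//; first exact: C_int (Phi_C (u + v)).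
  apply: (int_add (C_int (Phi_C u))).
  exact: (C_mul (dPhi_C u) (K_C v)).
have iR u v : mu.-integrable setT (EFin \o (fun t =>
    along Phi (u + v) t - (along Phi u t + along (d1 Phi 1) u t * K v t))).
  apply: (int_sub (C_int (Phi_C (u + v)))).
  apply: (int_add (C_int (Phi_C u))).
  exact: (C_mul (dPhi_C u) (K_C v)).
have [h0_gt0 _ HA3] := A3.
have conv q t : 0 <= d1 Phi 2 q (g t) t.
  by have := HA3 q t 0; rewrite normr0 addr0 => /(_ (ltW h0_gt0))[].
exists grad => u; split.
  move=> v; rewrite -subr_ge0 remE; apply: Rintegral_ge0 => t _.
  have [e [th [/andP[th0 _] _ E]]] :=
    second_order_mvt (K u t) (K v t) (fun x => d1_0 x (g t) t) (fun x => d1_1 x (g t) t).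
  rewrite /along KD opprD addrA E mulr_ge0//.
have [Bu HBu] := C_S1_bounded (K_C u); have [G HG] := C_S1_bounded g_C.
(* For |v| <= 1 the intermediate point stays within MK of K u t, and t may be reduced modulo 1; so
   one compact set contains all arguments of the second derivative. *)
pose A := `[- (Bu + MK), Bu + MK]%classic `*` `[- G, G]%classic `*` `[0 : R, 1]%classic.
have cA : compact A.
  by apply: compact_setX; [apply: compact_setX|]; exact: segment_compact.
have [M2 HM2] : exists M2, forall z, A z -> `|d1 Phi 2 z.1.1 z.1.2 z.2| <= M2.
  by apply: compact_bounded_fun => //; case: A4.
exists (`|M2| * MK ^+ 2); first by rewrite mulr_ge0// sqr_ge0.
move=> v v1; rewrite -lerBlDl remE; apply: int_le_sup => // t.
have [e [th [/andP[th0 ths] es E]]] :=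
  second_order_mvt (K u t) (K v t) (fun x => d1_0 x (g t) t) (fun x => d1_1 x (g t) t).
rewrite /along KD opprD addrA E.
have Kv : `|K v t| <= MK * `|v| by exact: HMK.
have Kv1 : `|K v t| <= MK by apply: le_trans Kv _; rewrite ler_piMr.
have dM : d1 Phi 2 e (g t) t <= `|M2|.
  have [t' t'01 ->] := periodic_reduce t (d1_periodic 2 e (g t)).
  apply: le_trans (ler_norm _) _; apply: le_trans (ler_norm M2).
  apply: (HM2 (e, g t, t')); split => //=; split => /=; rewrite in_itv/=.
    have := HBu t; have := le_trans es Kv1; rewrite !ler_norml => /andP[? ?] /andP[? ?].
    by apply/andP; split; lra.
  by have := HG t; rewrite ler_norml.
rewrite -mulrA; apply: ler_pM => //.
apply: le_trans ths _; rewrite -exprMn -[K v t ^+ 2]real_normK ?num_real//.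
by rewrite lerXn2r ?nnegrE ?mulr_ge0.
Qed.

End potential.

(** * Minimization of the energy *)

Section minimization.
Context {R : realType}.
Local Notation mu := (S1_measure R).
Variables (rho c : R) (V : L2 R -> R) (grad : L2 R -> L2 R).
Hypothesis rho0 : 0 < rho.
Hypothesis sep : @test_separating R.
Hypothesis V_ge : forall u, - c <= V u.
Hypothesis V_convex : forall u v, V u + inner (grad u) v <= V (u + v).
Hypothesis V_smooth : forall u, exists2 M : R, 0 <= M & forall v, `|v| <= 1 ->
  V (u + v) <= V u + inner (grad u) v + M * `|v| ^+ 2.

Lemma le_geometric (x y D : R) : (forall n, x <= y + D * 2^-1 ^+ n) -> x <= y.
Proof.
move=> H; have cD : (y + D * 2^-1 ^+ n) @[n --> \oo] --> y + D * 0.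
  apply: cvgD; first exact: cvg_cst.
  apply: cvgM; first exact: cvg_cst.
  by apply: cvg_expr; rewrite gtr0_norm ?invr_gt0// invf_lt1// ltr1n.
by have := cvgr_to_ge cD (nearW _ H); rewrite mulr0 addr0; apply.
Qed.

Lemma H1P (u : L2 R) : H1 u -> weak_deriv u (wderiv u).
Proof. by move=> [v uv]; rewrite (wderivE sep uv). Qed.

Definition energy (u : L2 R) : R := V u + rho / 2 * (`|u| ^+ 2 + `|wderiv u| ^+ 2).

Lemma norm_midpoint (x y : L2 R) :
  2 * `|x + 2^-1 *: (y - x)| ^+ 2 = `|x| ^+ 2 + `|y| ^+ 2 - 2^-1 * `|x - y| ^+ 2.
Proof.
rewrite !norm_sqr !(innerDl, innerDr, innerZl, innerZr, innerNl, innerNr) (innerC y x).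
by move: (inner x x) (inner x y) (inner y y) => a b e; field.
Qed.

(** At the midpoint z the tangent inequalities in the two opposite directions add up and the
    gradient cancels; the quadratic part obeys the parallelogram law, which yields the gap.
    Existence and uniqueness both rest on this bound. *)
Lemma energy_midpoint (u w : L2 R) : H1 u -> H1 w ->
  exists2 z, H1 z &
  rho / 4 * (`|u - w| ^+ 2 + `|wderiv u - wderiv w| ^+ 2) <=
    energy u + energy w - 2 * energy z.
Proof.
move=> /H1P Hu /H1P Hw; pose z := u + 2^-1 *: (w - u).
have Hd : weak_deriv (w - u) (wderiv w - wderiv u).
  by have := weak_deriv_comb (-1) Hw Hu; rewrite !scaleN1r.
have Hz : weak_deriv z (wderiv u + 2^-1 *: (wderiv w - wderiv u)) :=
  weak_deriv_comb 2^-1 Hu Hd.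
exists z; first by exists (wderiv u + 2^-1 *: (wderiv w - wderiv u)).
have Vmid : 2 * V z <= V u + V w.
  have half (x : L2 R) : 2^-1 *: x + 2^-1 *: x = x.
    by rewrite -scalerDl (_ : _ + _ = 1) ?scale1r//; lra.
  have uz : z + - (2^-1 *: (w - u)) = u by rewrite /z addrK.
  have wz : z + 2^-1 *: (w - u) = w by rewrite /z -addrA half addrCA subrr addr0.
  have := V_convex z (- (2^-1 *: (w - u))); have := V_convex z (2^-1 *: (w - u)).
  rewrite uz wz innerNr.
  by move: (V u) (V w) (V z) (inner _ _) => a b e k; lra.
have N1 : 2 * `|z| ^+ 2 = _ := norm_midpoint u w.
have N2 := norm_midpoint (wderiv u) (wderiv w).
rewrite /energy (wderivE sep Hz).
have arith (r vu vw vz a b z1 d a' b' z2 d' : R) : 2 * vz <= vu + vw ->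
    2 * z1 = a + b - 2^-1 * d -> 2 * z2 = a' + b' - 2^-1 * d' ->
    r / 4 * (d + d') <=
    vu + r / 2 * (a + a') + (vw + r / 2 * (b + b')) - 2 * (vz + r / 2 * (z1 + z2)).
  move=> h1 h2 h3.
  have -> : z1 = (a + b - 2^-1 * d) / 2 by lra.
  have -> : z2 = (a' + b' - 2^-1 * d') / 2 by lra.
  lra.
exact: (arith _ _ _ _ _ _ _ _ _ _ _ _ Vmid N1 N2).
Qed.

Lemma norm_sqr_lsc (l u : L2 R) : `|l| ^+ 2 <= `|u| ^+ 2 + 2 * `|l| * `|u - l|.
Proof.
have -> : `|u| ^+ 2 = `|l| ^+ 2 + 2 * inner l (u - l) + `|u - l| ^+ 2.
  by rewrite -norm_sqrD addrCA subrr addr0.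
have := cauchy_schwarz l (u - l); rewrite ler_norml => /andP[H _].
have := sqr_ge0 (`|u - l|); lra.
Qed.

Lemma energy_minimizer_exists : exists u, minimizer (@H1 R) energy u.
Proof.
pose S := [set energy u | u in @H1 R].
have S_ge : lbound S (- c).
  move=> _ [u _ <-]; apply: le_trans (V_ge u) _.
  by rewrite lerDl mulr_ge0 ?divr_ge0 ?(ltW rho0)// addr_ge0 ?sqr_ge0.
have S0 : S !=set0 by exists (energy 0), 0 => //; exists 0; exact: weak_deriv0.
have Sinf : has_inf S by split => //; exists (- c).
pose m := inf S.
have m_le u : H1 u -> m <= energy u.
  by move=> Hu; apply: ge_inf; [exists (- c)|exists u].
(* Two values within eps n of the infimum leave a midpoint gap of at most 2 eps n = rho / 4 *
   (2^-n)^2, which gives exactly the increments 2^-n required by [L2_complete]. *)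
pose eps n : R := rho / 8 * (2^-1 ^+ n) ^+ 2.
have eps0 n : 0 < eps n.
  by rewrite mulr_gt0 ?divr_gt0// exprn_gt0// exprn_gt0// invr_gt0.
have ex n : exists u, H1 u /\ energy u < m + eps n.
  by have [_ [u Hu <-] ?] := inf_adherent (eps0 n) Sinf; exists u.
pose u n := projT1 (cid (ex n)).
have Hu n : H1 (u n) by rewrite /u; case: cid => x [].
have Eu n : energy (u n) < m + eps n by rewrite /u; case: cid => x [].
have pow_ge0 n : 0 <= 2^-1 ^+ n :> R by rewrite exprn_ge0// invr_ge0.
have step n : `|u n.+1 - u n| ^+ 2 + `|wderiv (u n.+1) - wderiv (u n)| ^+ 2
    <= (2^-1 ^+ n) ^+ 2.
  have [z Hz Ez] := energy_midpoint (Hu n.+1) (Hu n).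
  have := m_le _ Hz; have := Eu n; have := Eu n.+1.
  have en : eps n.+1 <= eps n.
    rewrite ler_pM2l ?divr_gt0// lerXn2r ?nnegrE// exprS ler_piMl//.
    by rewrite invf_le1// ler1n.
  move=> E1 E2 E3; rewrite -(@ler_pM2l _ (rho / 4)) ?divr_gt0//.
  apply: le_trans Ez _; move: en E1 E2 E3; rewrite /eps; set e := (2^-1 ^+ n) ^+ 2.
  set e' := (2^-1 ^+ n.+1) ^+ 2; lra.
have s1 n : `|u n.+1 - u n| <= 2^-1 ^+ n.
  by rewrite -ler_sqr ?nnegrE//; apply: le_trans (step n); rewrite lerDl sqr_ge0.
have s2 n : `|wderiv (u n.+1) - wderiv (u n)| <= 2^-1 ^+ n.
  by rewrite -ler_sqr ?nnegrE//; apply: le_trans (step n); rewrite lerDr sqr_ge0.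
have [l Hl] := L2_complete s1.
have [l' Hl'] := L2_complete (u := fun n => wderiv (u n)) s2.
have wl : weak_deriv l l'.
  by apply: (weak_deriv_closed (fun n => H1P (Hu n))).
exists l; split; first by exists l'.
move=> v Hv; apply: le_trans (m_le _ Hv).
rewrite /energy (wderivE sep wl).
(* The three terms bound the errors from the tangent inequality for V at l, from the lower
   semicontinuity of the two norms, and from eps n. *)
apply: (@le_geometric _ _ (`|grad l| * 2 + rho * (2 * `|l| + 2 * `|l'|) + rho / 8)) => n.
have vl : V l <= V (u n) + `|grad l| * (2 * 2^-1 ^+ n).
  have := V_convex l (u n - l); rewrite addrCA subrr addr0.
  have := cauchy_schwarz (grad l) (u n - l); rewrite ler_norml => /andP[H _].
  have : `|grad l| * `|u n - l| <= `|grad l| * (2 * 2^-1 ^+ n) by rewrite ler_wpM2l.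
  lra.
have nl : `|l| ^+ 2 <= `|u n| ^+ 2 + 2 * `|l| * (2 * 2^-1 ^+ n).
  apply: le_trans (norm_sqr_lsc l (u n)) _.
  by rewrite lerD2l ler_wpM2l// mulr_ge0.
have nl' : `|l'| ^+ 2 <= `|wderiv (u n)| ^+ 2 + 2 * `|l'| * (2 * 2^-1 ^+ n).
  apply: le_trans (norm_sqr_lsc l' (wderiv (u n))) _.
  by rewrite lerD2l ler_wpM2l// mulr_ge0.
have en : eps n <= rho / 8 * 2^-1 ^+ n.
  rewrite ler_pM2l ?divr_gt0// expr2 ler_piMl//.
  by rewrite exprn_ile1// ?invr_ge0// invf_le1// ler1n.
have := Eu n; rewrite /energy => En.
have : rho / 2 * (`|l| ^+ 2 + `|l'| ^+ 2) <= rho / 2 *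
    (`|u n| ^+ 2 + 2 * `|l| * (2 * 2^-1 ^+ n) +
     (`|wderiv (u n)| ^+ 2 + 2 * `|l'| * (2 * 2^-1 ^+ n))).
  by rewrite ler_pM2l ?divr_gt0// lerD.
move: vl En en; set x := 2^-1 ^+ n; set e := eps n.
lra.
Qed.

Lemma energy_minimizer_unique (u w : L2 R) :
  minimizer (@H1 R) energy u -> minimizer (@H1 R) energy w -> u = w.
Proof.
move=> [Hu mu_] [Hw mw]; have [z Hz Ez] := energy_midpoint Hu Hw.
have := mu_ _ Hz; have := mw _ Hz; move=> E1 E2.
apply/eqP; rewrite -subr_eq0 -normr_eq0 -sqrf_eq0 eq_le sqr_ge0 andbT.
rewrite -(@ler_pM2l _ (rho / 4)) ?divr_gt0// mulr0.
have : 0 <= rho / 4 * `|wderiv u - wderiv w| ^+ 2.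
  by rewrite mulr_ge0 ?sqr_ge0// divr_ge0// ltW.
lra.
Qed.

Lemma linear_coef_eq0 (A B d : R) : 0 < d -> 0 <= B ->
  (forall s, `|s| <= d -> 0 <= s * A + s ^+ 2 * B) -> A = 0.
Proof.
move=> d0 B0 H; apply/eqP/negP => /negP A0.
have A1 : 0 < `|A| + 1 by rewrite ltr_wpDl.
(* At s = - t A the expression is t A^2 (t B - 1), negative once t B < 1; the first bound on t keeps
   |s| <= d. *)
pose t := Num.min (d / (`|A| + 1)) (B + 1)^-1.
have B1 : 0 < B + 1 by rewrite ltr_wpDl.
have t0 : 0 < t by rewrite lt_min divr_gt0//= invr_gt0.
have t1 : t * `|A| <= d.
  have : t <= d / (`|A| + 1) by rewrite ge_min lexx.
  rewrite ler_pdivlMr//; apply: le_trans; rewrite ler_pM2l//; lra.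
have t2 : t * B < 1.
  have : t <= (B + 1)^-1 by rewrite ge_min lexx orbT.
  rewrite -[X in _ <= X]mul1r ler_pdivlMr//; lra.
have := H (- (t * A)); rewrite normrN normrM (gtr0_norm t0) => /(_ t1).
have -> : - (t * A) * A + (- (t * A)) ^+ 2 * B = (t * A ^+ 2) * (t * B - 1) by ring.
rewrite pmulr_rge0; last by rewrite mulr_gt0// exprn_even_gt0.
lra.
Qed.

(** Varying u along test functions only already gives, word for word, the definition of a weak
    derivative of [wderiv u]. Thus H^2 regularity of u comes with the equation. *)
Lemma euler_lagrange (u : L2 R) : minimizer (@H1 R) energy u ->
  calL u (- (rho^-1 *: grad u)).
Proof.
move=> [Hu minu]; have wu := H1P Hu.
exists (wderiv u), (u + rho^-1 *: grad u); split => //; last first.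
  by rewrite opprD addrAC addNr add0r.
apply/weak_derivP => phi H; set p := L2_test H; set p' := L2_test _.
have [M M0 HM] := V_smooth u.
pose A := inner (grad u) p + rho * (inner u p + inner (wderiv u) p').
suff A0 : A = 0.
  apply: (@mulfI _ rho); first by rewrite gt_eqF.
  rewrite innerDl innerZl mulrN mulrDr mulrA divff ?gt_eqF// mul1r.
  by move: A0; rewrite /A; lra.
pose d : R := (`|p| + 1)^-1.
have p1 : 0 < `|p| + 1 by rewrite ltr_wpDl.
apply: (@linear_coef_eq0 A (M * `|p| ^+ 2 + rho / 2 * (`|p| ^+ 2 + `|p'| ^+ 2)) d).
- by rewrite invr_gt0.
- by rewrite addr_ge0 ?mulr_ge0 ?sqr_ge0 ?addr_ge0 ?sqr_ge0 ?divr_ge0 ?(ltW rho0).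
move=> s sd.
have Hs := weak_deriv_comb s wu (L2_test_deriv H); rewrite -/p -/p' in Hs.
have := minu (u + s *: p) (ex_intro _ _ Hs).
rewrite /energy (wderivE sep Hs) !norm_sqrD !innerZr !normrZ !exprMn.
rewrite !(real_normK (num_real s)).
have := HM (s *: p); rewrite innerZr normrZ exprMn real_normK ?num_real//.
have -> : `|s| * `|p| <= 1.
  apply: (@le_trans _ _ (d * (`|p| + 1))); last by rewrite mulVf ?gt_eqF.
  by rewrite ler_pM// lerDl.
move=> /(_ isT) H1 H2; rewrite /A.
set s2 := s ^+ 2 in H1 H2 *; set x := `|p| ^+ 2 in H1 H2 *.
set y := `|p'| ^+ 2 in H2 *.
lra.
Qed.

End minimization.

(** * Concentration of the Gibbs measure *)

Lemma half_le_sub {R : realFieldType} (y : R) : y <= 4^-1 -> 2^-1 <= 1 - (4^-1 + y).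
Proof. lra. Qed.

Section concentration.
Context {R : realType}.
Variables (V : L2 R -> R) (grad : L2 R -> L2 R).
Hypothesis V_convex : forall u v, V u + inner (grad u) v <= V (u + v).
Hypothesis V_smooth : forall u, exists2 M : R, 0 <= M & forall v, `|v| <= 1 ->
  V (u + v) <= V u + inner (grad u) v + M * `|v| ^+ 2.

Lemma potential_continuous : continuous V.
Proof.
apply/L2_continuousP => u e e0; have [M M0 HM] := V_smooth u.
have D0 : 0 < `|grad u| + M + 1 by rewrite ltr_wpDl// addr_ge0.
exists (Num.min 1 (e / (`|grad u| + M + 1))); first by rewrite lt_min ltr01 divr_gt0.
move=> f; rewrite lt_min distrC => /andP[f1]; rewrite ltr_pdivlMr// => f2.
have fE : u + (f - u) = f by rewrite addrCA subrr addr0.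
have := HM (f - u) (ltW f1); have := V_convex u (f - u); rewrite fE.
have := cauchy_schwarz (grad u) (f - u); rewrite ler_norml => /andP[].
have n0 : 0 <= `|f - u| by exact: normr_ge0.
have : M * `|f - u| ^+ 2 <= M * `|f - u|.
  by rewrite ler_wpM2l// expr2 ler_piMl// ltW.
move: f1 f2 n0; move: (inner _ _) (V u) (V f) (`|f - u|) (`|grad u|) => i a b x k.
by move=> f1 f2 n0 h1 h2 h3 h4 h5; rewrite ltr_norml; apply/andP; split; lra.
Qed.

Lemma measurable_norm_sub (u : L2 R) :
  measurable_fun [set: Borel (L2 R)] (fun f : Borel (L2 R) => `|(f : L2 R) - u|).
Proof.
apply: borel_continuous_measurable.
apply/L2_continuousP => f e e0; exists e => // g fg.
apply: le_lt_trans fg; apply: le_trans (ler_dist_dist _ _) _.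
by rewrite opprB addrA subrK.
Qed.

Definition far (u : L2 R) (e : R) : set (Borel (L2 R)) :=
  [set f : Borel (L2 R) | e <= `|(f : L2 R) - u|].

Lemma measurable_far u e : measurable (far u e).
Proof.
rewrite -[X in measurable X]setTI.
have -> : far u e = (fun f : Borel (L2 R) => `|(f : L2 R) - u|) @^-1` `[e, +oo[.
  by apply/seteqP; split => f /=; rewrite in_itv/= andbT.
by apply: (measurable_norm_sub u) => //; exact: measurable_itv.
Qed.

Variables (rho tau : R) (nu mu : probability (Borel (L2 R)) R) (C : L2 R -> L2 R).
Hypothesis rho0 : 0 < rho.
Hypothesis tau0 : 0 < tau.
Hypothesis HC : inverse_operator (scaled (tau * rho) (@calL R)) C.
Hypothesis Hnu : gaussian_measure nu 0 C.
Hypothesis Hmu : gibbs_measure nu mu (fun f => tau * V f).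
Variables (u : L2 R) (M : R).
Hypothesis M0 : 0 <= M.
Hypothesis HM : forall v, `|v| <= 1 ->
  V (u + v) <= V u + inner (grad u) v + M * `|v| ^+ 2.
Hypothesis Cu : C (- (tau *: grad u)) = u.

Let h := - (tau *: grad u).
Let W (f : Borel (L2 R)) : R := expR (inner (f : L2 R) h).
Let X (f : Borel (L2 R)) : R := expR (- (tau * V f)).
Let D (f : Borel (L2 R)) : R := `|(f : L2 R) - u| ^+ 2.
(** Chosen so that kappa * W is the Gibbs factor with V replaced by its tangent at u. *)
Let kappa : R := expR (- (tau * V u) - inner u h).
Let E0 : R := expR (inner (C h) h / 2).
(** S / tau bounds the second moment about u of the normalized tilted measure. *)
Let S : R := 72 * expR 2^-1 / rho.

Let a0 : 0 < tau * rho. Proof. exact: mulr_gt0. Qed.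

Let S0 : 0 < S. Proof. by rewrite divr_gt0// mulr_gt0// expR_gt0. Qed.

Let mW : measurable_fun [set: Borel (L2 R)] W.
Proof. exact: (measurableT_comp (@measurable_expR R) (measurable_inner h)). Qed.

Let mX : measurable_fun [set: Borel (L2 R)] X.
Proof.
apply: (measurableT_comp (@measurable_expR R)).
apply: measurableT_comp => //; apply: measurable_funM => //.
by apply: borel_continuous_measurable; exact: potential_continuous.
Qed.

Let mD : measurable_fun [set: Borel (L2 R)] D.
Proof. by apply: measurable_funX; exact: measurable_norm_sub. Qed.

Let W0 f : 0 < W f. Proof. exact: expR_gt0. Qed.
Let X0 f : 0 < X f. Proof. exact: expR_gt0. Qed.
Let D0 f : 0 <= D f. Proof. exact: sqr_ge0. Qed.

Let mass : (\int[nu]_f (W f)%:E = E0%:E)%E.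
Proof. exact: (gaussian_mgf a0 HC Hnu h). Qed.

Let moment : (\int[nu]_f (D f * W f)%:E <= (S / tau * E0)%:E)%E.
Proof.
have := tilted_norm_moment a0 HC Hnu h; rewrite /E0 /D /W.
have -> : C h = u := Cu.
have -> : S / tau = 72 * expR 2^-1 / (tau * rho).
  by rewrite /S invfM mulrA -!mulrA (mulrC tau^-1).
exact.
Qed.

Let tiltE f (v := (f : L2 R) - u) : kappa * W f = expR (- (tau * (V u + inner (grad u) v))).
Proof.
rewrite /kappa /W -expRD /h /v innerBr !innerNr !innerZr !(innerC _ (grad u)).
by congr expR; move: (inner _ _) (inner _ _) (V u) => x y z; ring.
Qed.

Let X_le f : X f <= kappa * W f.
Proof.
rewrite tiltE ler_expR lerN2 ler_pM2l//.
by have := V_convex u ((f : L2 R) - u); rewrite addrCA subrr addr0.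
Qed.

(** A pointwise lower bound ready for integration. Where (tau / (4 S) + 1) D <= 1, the first summand
    gives tau D <= 4 S and the second D <= 1, which the quadratic upper bound on V requires;
    elsewhere the added term alone dominates. *)
Let X_ge f : kappa * expR (- (4 * M * S)) * W f <=
  X f + kappa * expR (- (4 * M * S)) * ((tau / (4 * S) + 1) * (D f * W f)).
Proof.
set k := kappa * expR _.
have k0 : 0 < k by rewrite mulr_gt0// expR_gt0.
have t4 : 0 < tau / (4 * S) by rewrite divr_gt0// mulr_gt0.
have [Dsmall|Dbig] := leP ((tau / (4 * S) + 1) * D f) 1; last first.
  apply: (@le_trans _ _ (k * ((tau / (4 * S) + 1) * (D f * W f)))).
    by rewrite ler_pM2l// mulrA -[leLHS]mul1r ler_pM2r// ltW.
  by rewrite lerDr ltW.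
have D1 : D f <= 1.
  apply: le_trans Dsmall; rewrite mulrDl mul1r lerDr mulr_ge0// ltW//.
have Dt : tau * D f <= 4 * S.
  have : tau / (4 * S) * D f <= 1.
    by apply: le_trans Dsmall; rewrite ler_wpM2r// lerDl.
  by rewrite mulrAC ler_pdivrMr ?mul1r// mulr_gt0.
have n1 : `|(f : L2 R) - u| <= 1.
  by rewrite -(@expr_le1 _ 2).
apply: (@le_trans _ _ (X f)); last first.
  have t1 : 0 <= tau / (4 * S) + 1 by rewrite addr_ge0// ltW.
  by rewrite lerDl (mulr_ge0 (ltW k0))// mulr_ge0// mulr_ge0// ltW.
rewrite /k mulrAC tiltE -expRD ler_expR.
have := HM n1; rewrite addrCA subrr addr0.
have MD : M * (tau * D f) <= M * (4 * S) by rewrite ler_wpM2l.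
rewrite -/(D f) -(ler_pM2l tau0) => H.
move: H MD; move: (V f) (V u) (inner _ _) (D f) => vf vu i d; lra.
Qed.

(** Chebyshev's inequality: D / e^2 >= 1 on the far set, and X is below kappa * W. *)
Let numerator (e : R) : 0 < e ->
  (\int[nu]_(f in far u e) (X f)%:E <= (kappa * (S / tau * E0) / e ^+ 2)%:E)%E.
Proof.
move=> e0; have ke0 : 0 <= kappa / e ^+ 2 by rewrite divr_ge0 ?expR_ge0 ?sqr_ge0.
have mXE : measurable_fun [set: Borel (L2 R)] (fun f => (X f)%:E) by exact/measurable_EFinP.
have mDW : measurable_fun [set: Borel (L2 R)] (fun f => (D f * W f)%:E).
  by apply/measurable_EFinP; exact: measurable_funM.
have DW0 f : (0 <= (D f * W f)%:E)%E by rewrite lee_fin mulr_ge0// ltW.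
apply: (@le_trans _ _ (\int[nu]_f ((kappa / e ^+ 2)%:E * (D f * W f)%:E))%E).
  rewrite integral_mkcond; apply: ge0_le_integral; first exact: measurableT.
  - by move=> f _; rewrite patchE; case: ifP => // _; rewrite lee_fin ltW.
  - exact: ((measurable_restrictT (fun f => (X f)%:E) (measurable_far u e)).1
      (measurable_funTS mXE)).
  - exact: emeasurable_funM.
  - move=> f _; rewrite patchE -EFinM; case: ifPn => [|_]; last first.
      by rewrite lee_fin !mulr_ge0// ?expR_ge0 ?invr_ge0 ?sqr_ge0// ltW.
    rewrite inE => ef; rewrite lee_fin; apply: le_trans (X_le f) _.
    rewrite -mulrA ler_pM2l ?expR_gt0// mulrA -[leLHS]mul1r ler_pM2r//.
    rewrite ler_pdivlMl ?exprn_gt0// mulr1 lerXn2r ?nnegrE ?(ltW e0)//; exact: ef.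
rewrite ge0_integralZl//.
rewrite (_ : kappa * _ / _ = kappa / e ^+ 2 * (S / tau * E0)); last by rewrite mulrAC.
by rewrite [leRHS]EFinM lee_wpmul2l.
Qed.

Let Z := (\int[nu]_f (X f)%:E)%E.

Let denominator : 4 * S <= tau ->
  ((kappa * expR (- (4 * M * S)) * (E0 / 2))%:E <= Z)%E.
Proof.
move=> tS; set k := kappa * expR _.
have k0 : 0 < k by rewrite mulr_gt0// expR_gt0.
pose t := tau / (4 * S) + 1.
have t0 : 0 < t by rewrite addr_gt0// divr_gt0// mulr_gt0.
have mDW : measurable_fun [set: Borel (L2 R)] (fun f => (D f * W f)%:E).
  by apply/measurable_EFinP; exact: measurable_funM.
have DW0 f : (0 <= (D f * W f)%:E)%E by rewrite lee_fin mulr_ge0// ltW.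
have mXE : measurable_fun [set: Borel (L2 R)] (fun f => (X f)%:E) by exact/measurable_EFinP.
have mWE : measurable_fun [set: Borel (L2 R)] (fun f => (W f)%:E) by exact/measurable_EFinP.
have XE0 f : (0 <= (X f)%:E)%E by rewrite lee_fin ltW.
have WE0 f : (0 <= (W f)%:E)%E by rewrite lee_fin ltW.
have mkDW : measurable_fun [set: Borel (L2 R)] (fun f => (k * t)%:E * (D f * W f)%:E)%E.
  exact: emeasurable_funM.
have kDW0 f : (0 <= (k * t)%:E * (D f * W f)%:E)%E.
  by rewrite mule_ge0// lee_fin ltW// mulr_gt0.
have H1 : (\int[nu]_f (k%:E * (W f)%:E) <=
    \int[nu]_f ((X f)%:E + (k * t)%:E * (D f * W f)%:E))%E.
  apply: ge0_le_integral; first exact: measurableT.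
  - by move=> f _; rewrite mule_ge0// lee_fin ltW.
  - exact: emeasurable_funM.
  - exact: (emeasurable_funD mXE mkDW).
  - by move=> f _; rewrite -!EFinM -EFinD lee_fin -(mulrA k t); exact: X_ge.
have I1 : (\int[nu]_f (k%:E * (W f)%:E) = (k * E0)%:E)%E.
  by rewrite ge0_integralZl ?mass ?EFinM// lee_fin ltW.
have I2 : (\int[nu]_f ((X f)%:E + (k * t)%:E * (D f * W f)%:E) =
    Z + \int[nu]_f ((k * t)%:E * (D f * W f)%:E))%E.
  exact: (ge0_integralD nu measurableT (fun f _ => XE0 f) mXE (fun f _ => kDW0 f) mkDW).
have I3 : (\int[nu]_f ((k * t)%:E * (D f * W f)%:E) <= (k * t * (S / tau * E0))%:E)%E.
  rewrite ge0_integralZl//; last by rewrite lee_fin ltW// mulr_gt0.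
  by rewrite [leRHS]EFinM lee_wpmul2l// lee_fin ltW// mulr_gt0.
rewrite I1 I2 in H1.
have H2 := le_trans H1 (leeD2l Z I3).
have H3 : ((k * E0 - k * t * (S / tau * E0))%:E <= Z)%E.
  by rewrite EFinB leeBlDr.
apply: le_trans H3; rewrite lee_fin.
have -> : k * E0 - k * t * (S / tau * E0) = k * (E0 * (1 - t * (S / tau))) by ring.
rewrite ler_pM2l// ler_pM2l ?expR_gt0//.
(* By 4 S <= tau both terms are at most 1/4, so at least half of the tilted mass remains. *)
have -> : t * (S / tau) = 4^-1 + S / tau.
  by rewrite /t; field; rewrite !gt_eqF.
by apply: half_le_sub; rewrite ler_pdivrMr// mulrC ler_pdivlMr// mulrC.
Qed.

Lemma gibbs_concentration (e : R) : 0 < e -> 4 * S <= tau ->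
  (mu (far u e) <= (2 * expR (4 * M * S) * S / (tau * e ^+ 2))%:E)%E.
Proof.
move=> e0 tS; rewrite (Hmu (measurable_far u e)) -/Z.
(* This upper bound makes Z finite: [gibbs_measure] divides by the real number [fine Z], which would
   be 0 for an infinite integral. *)
have Zle : (Z <= (kappa * E0)%:E)%E.
  rewrite EFinM -mass -ge0_integralZl//; last 3 first.
  - exact/measurable_EFinP.
  - by move=> f _; rewrite lee_fin ltW.
  - by rewrite lee_fin expR_ge0.
  apply: ge0_le_integral; first exact: measurableT.
  - by move=> f _; rewrite lee_fin ltW.
  - exact/measurable_EFinP.
  - by apply: emeasurable_funM => //; exact/measurable_EFinP.
  - by move=> f _; rewrite -EFinM lee_fin X_le.
have Zge := denominator tS.
have E00 : 0 < E0 by exact: expR_gt0.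
have kap0 : 0 < kappa by exact: expR_gt0.
have Zfin : Z \is a fin_num.
  rewrite ge0_fin_numE; first exact: le_lt_trans Zle (ltry _).
  by apply: integral_ge0 => f _; rewrite lee_fin ltW.
set k := kappa * expR (- (4 * M * S)) * (E0 / 2) in Zge.
have k0 : 0 < k by rewrite !mulr_gt0 ?expR_gt0// invr_gt0.
have Zr : k <= fine Z by rewrite -lee_fin fineK.
have Z0 : 0 < fine Z by exact: lt_le_trans Zr.
apply: (@le_trans _ _ ((k^-1)%:E * (kappa * (S / tau * E0) / e ^+ 2)%:E)%E).
  apply: lee_pmul.
  - by rewrite lee_fin invr_ge0 ltW.
  - by apply: integral_ge0 => f _; rewrite lee_fin expR_ge0.
  - by rewrite lee_fin lef_pV2 ?posrE.
  - exact: numerator.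
rewrite -EFinM lee_fin le_eqVlt; apply/orP; left; apply/eqP.
rewrite /k expRN; have := expR_gt0 (4 * M * S); move: (expR _) => x x0.
by field; rewrite !gt_eqF.
Qed.

End concentration.

(** * Weak convergence to a Dirac mass, and the conclusion *)

Lemma half_add_lt {R : realFieldType} (e B x : R) : 0 <= x ->
  x * (2 * B + 1) < e / 2 -> e / 2 + 2 * B * x < e.
Proof. lra. Qed.

(** Near u the integrand F u - F x is below e / 2 by continuity; on the far set it is at most 2
    B. *)
Lemma weak_cvg_dirac (R : realType) (mu : nat -> probability (Borel (L2 R)) R)
    (u : L2 R) :
  (forall e, 0 < e -> fine (mu N (far u e)) @[N --> \oo] --> 0) ->
  weak_cvg mu (dirac (u : Borel (L2 R))).
Proof.
move=> Hmu F cF bF.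
have mF : measurable_fun [set: Borel (L2 R)] (F : Borel (L2 R) -> R).
  exact: borel_continuous_measurable.
have -> : \int[dirac (u : Borel (L2 R))]_x F x = F u.
  rewrite /Rintegral integral_dirac//; last exact/measurable_EFinP.
  by rewrite diracT mul1e.
have [B0 [_ /(_ (B0 + 1))]] := bF; rewrite ltrDl ltr01 => /(_ erefl) HB.
set B := B0 + 1 in HB.
have FB x : `|F x| <= B by exact: HB.
have B_ge0 : 0 <= B by apply: le_trans (FB u).
have iF N : (mu N).-integrable setT (EFin \o (F : Borel (L2 R) -> R)).
  apply: measurable_bounded_integrable => //.
  by rewrite [X in (X < _)%E]probability_setT ltry.
apply/cvgrPdist_lt => e e0.
have e2 : 0 < e / 2 by rewrite divr_gt0.
have [d d0 Hd] := (L2_continuousP F).1 cF u _ e2.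
have B2 : 0 < 2 * B + 1 by rewrite ltr_wpDl// mulr_ge0.
(* The summand 1 keeps the denominator positive when B = 0. *)
have /cvgrPdist_lt/(_ (e / 2 / (2 * B + 1))) := Hmu d d0.
rewrite divr_gt0// => /(_ erefl); apply: filterS => N.
rewrite sub0r normrN ger0_norm ?fine_ge0// ltr_pdivlMr// => HN.
have iFu : (mu N).-integrable setT (EFin \o (fun x : Borel (L2 R) => F u - F x)).
  apply: measurable_bounded_integrable => //.
  - by rewrite [X in (X < _)%E]probability_setT ltry.
  - exact: measurable_funB.
  - exists (B + B); split; first exact: num_real.
    move=> y By x _; apply: le_trans (ltW By).
    by apply: le_trans (ler_normB _ _) _; rewrite lerD.
have -> : F u - \int[mu N]_x F x = \int[mu N]_x (F u - F x).
  rewrite RintegralB//; [|exact: (@finite_measure_integrable_cst _ _ _ (mu N))|exact: iF].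
  by rewrite Rintegral_cst// [X in _ * fine X]probability_setT mulr1.
apply: le_lt_trans (le_normr_Rintegral measurableT iFu) _.
have mfar := measurable_far u d.
have mind : measurable_fun [set: Borel (L2 R)] (\1_(far u d) : Borel (L2 R) -> R).
  exact: measurable_indic.
have i1 : (mu N).-integrable setT (EFin \o (\1_(far u d) : Borel (L2 R) -> R)).
  apply: measurable_bounded_integrable => //.
    by rewrite [X in (X < _)%E]probability_setT ltry.
  exists 1; split; first exact: num_real.
  move=> y y1 x _ /=; rewrite indicE.
  by case: (_ \in _); rewrite ?normr1 ?normr0 ltW// (lt_trans _ y1).
have iind : (mu N).-integrable setT
    (EFin \o (fun x : Borel (L2 R) => 2 * B * \1_(far u d) x)).
  exact: integrable_mull.
have icst : (mu N).-integrable setT (EFin \o (fun x : Borel (L2 R) => e / 2)).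
  exact: (@finite_measure_integrable_cst _ _ _ (mu N)).
have isum : (mu N).-integrable setT
    (EFin \o (fun x : Borel (L2 R) => e / 2 + 2 * B * \1_(far u d) x)).
  by have := integrableD measurableT icst iind; apply: eq_integrable.
apply: (@le_lt_trans _ _ (\int[mu N]_x (e / 2 + 2 * B * \1_(far u d) x))).
  apply: le_Rintegral => //.
  - exact: (integrable_norm iFu).
  - move=> x _; rewrite indicE; case: (boolP (x \in far u d)) => xf.
      rewrite mulr1 -[leLHS]add0r lerD// ?(ltW e2)//.
      by apply: le_trans (ler_normB _ _) _; rewrite mulr_natl mulr2n lerD.
    rewrite mulr0 addr0; apply/ltW/Hd; rewrite ltNge distrC; apply/negP => xd.
    by move: xf; rewrite mem_set.
rewrite RintegralD// Rintegral_cst// [X in _ * fine X + _]probability_setT mulr1.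
have -> : \int[mu N]_x (2 * B * \1_(far u d) x) = 2 * B * fine (mu N (far u d)).
  rewrite RintegralZl//.
  by rewrite /Rintegral integral_indic// setIT.
have f0 : 0 <= fine (mu N (far u d)) by rewrite fine_ge0.
exact: half_add_lt f0 HN.
Qed.

Theorem mainTheorem6 (R : realType) (rho : R) (w g : R -> R)
    (Phi : R -> R -> R -> R) (K : {linear L2 R -> (R -> R)})
    (h0 c : R) (N1 : nat) (tau : nat -> R)
    (nu mu : nat -> probability (Borel (L2 R)) R) :
  0 < rho ->
  (forall p v, periodic (Phi p v) 1) ->
  assumption_A1 w ->
  assumption_A2 g K ->
  assumption_A3 g Phi h0 c ->
  assumption_A4 Phi ->
  admissible_N1 w g h0 N1 ->
  assumption_A5 rho w g Phi K N1 ->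
  (forall N, (0 < N)%N -> 0 < tau N) ->
  tau @ \oo --> +oo ->
  (forall N, (0 < N)%N -> exists2 C : L2 R -> L2 R,
     inverse_operator (scaled (tau N * rho) (@calL R)) C &
     gaussian_measure (nu N) 0 C) ->
  (forall N, (0 < N)%N ->
     gibbs_measure (nu N) (mu N) (fun f => tau N * Psi g Phi K f)) ->
  exists2 u : L2 R,
    unique (minimizer (@H1 R) (Psi_full rho g Phi K)) u &
    weak_cvg mu (dirac (u : Borel (L2 R))).
Proof.
move=> rho0 perPhi _ A2 A3 A4 _ _ tau0 tauy Hnu Hmu.
have sep : @test_separating R.
  by have [C HC _] := Hnu 1%N erefl; exact: inverse_operator_separating HC.
have [grad Hgrad] := Psi_gradient perPhi A2 A3 A4.
have Vge := Psi_ge perPhi A2 A3 A4.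
have Vconv u v := (Hgrad u).1 v.
have Vsm u := (Hgrad u).2.
have -> : Psi_full rho g Phi K = energy rho (Psi g Phi K).
  apply/funext => f; rewrite /Psi_full /energy; congr (_ + _ * _).
  rewrite !norm_sqr -RintegralD//; [|exact: inner_integrable..].
  by apply: eq_Rintegral => t _; rewrite -!expr2 real_normK ?num_real.
have [u minu] := energy_minimizer_exists rho0 sep Vge Vconv.
exists u.
  by split => // v minv; exact: (energy_minimizer_unique rho0 sep Vconv minu minv).
have EL := euler_lagrange rho0 sep Vsm minu.
have [M M0 HM] := Vsm u.
apply: weak_cvg_dirac => e e0.
set S : R := 72 * expR 2^-1 / rho.
pose bnd N := 2 * expR (4 * M * S) * S / e ^+ 2 * (tau N)^-1.
have bnd0 : bnd N @[N --> \oo] --> 0.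
  rewrite -(mulr0 (2 * expR (4 * M * S) * S / e ^+ 2)).
  apply: cvgM; first exact: cvg_cst.
  apply/(gtr0_cvgV0 _) => //.
  by exists 1%N => // N /= N0; exact: tau0.
apply: (@squeeze_cvgr _ _ _ _ (fun=> 0) bnd); last 2 first.
- exact: cvg_cst.
- exact: bnd0.
near=> N.
have N0 : (0 < N)%N by near: N; exact: nbhs_infty_gt.
have tS : 4 * S <= tau N by near: N; move/cvgryPge: tauy; apply.
rewrite fine_ge0//=.
have [C HC Hg] := Hnu N N0.
(* The Euler-Lagrange equation multiplied by tau N * rho: the tilted mean is the same u for every
   N. *)
have Cu : C (- (tau N *: grad u)) = u.
  apply/HC; exists (- (rho^-1 *: grad u)) => //.
  by rewrite scalerN scalerA mulfK// gt_eqF.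
have := gibbs_concentration Vconv Vsm rho0 (tau0 N N0) HC Hg (Hmu N N0) M0 HM Cu e0 tS.
rewrite -/S => H; rewrite -lee_fin fineK ?fin_num_measure//; last exact: measurable_far.
apply: le_trans H _; rewrite lee_fin /bnd invfM le_eqVlt; apply/orP; left; apply/eqP.
by move: (tau N)^-1 (e ^+ 2)^-1 => a b; ring.
Unshelve. all: end_near. Qed.
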